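(* Let $k>\ell\ge 2$ be fixed integers and let $\varepsilon>0$ be a fixed real number. Let $c\ge 1/(k-\ell)$ be a fixed real number and let $r=cn$ (rounded up or down to an integer, arbitrarily). All limits are taken as $n\to\infty$ over multiples $n$ of $k-\ell$, and $p=p(n)\in[0,1]$. Then the following hold. (i) For all integers $k>\ell\ge 2$, if $$p\le \begin{cases}(1-\varepsilon)\,e^{k-\ell+1}/n^{k-\ell} & \text{if } c=1/(k-\ell),\\[4pt] (1-\varepsilon)\left(\dfrac{c-1/(k-\ell)}{c}\right)^{(k-\ell)c-1} e^{k-\ell+1}/n^{k-\ell} & \text{if } c>1/(k-\ell),\end{cases}$$ then with high probability $H_{n,p,r}^{(k)}$ is not rainbow $\ell$-Hamiltonian. (ii) For all integers $k>\ell\ge 3$, there exists a constant $K=K(k)$ (depending only on $k$) such that if $p\ge K/n^{k-\ell}$ and $n$ is a multiple of $k-\ell$, then with high probability $H_{n,p,r}^{(k)}$ is rainbow $\ell$-Hamiltonian. (iii) If $k>\ell=2$, $p\ge \omega/n^{k-2}$, where $\omega=\omega(n)$ is any function with $\omega(n)\to\infty$, and $n$ is a multiple of $k-2$, then with high probability $H_{n,p,r}^{(k)}$ is rainbow $2$-Hamiltonian. (iv) For all $k\ge 4$, with $\ell=k-1$ (so that $c\ge 1$), if $$p\ge \begin{cases}(1+\varepsilon)\,e^2/n & \text{if } c=1,\\[4pt] (1+\varepsilon)\left(\dfrac{c-1}{c}\right)^{c-1} e^2/n & \text{if } c>1,\end{cases}$$ then with high probability $H_{n,p,r}^{(k)}$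 is rainbow $(k-1)$-Hamiltonian, i.e. it contains a rainbow tight Hamilton cycle.
   Context: $H_{n,p,r}^{(k)}$ denotes the randomly colored random $k$-uniform hypergraph on vertex set $[n]=\{1,\dots,n\}$: each $k$-element subset of $[n]$ is included as an edge independently with probability $p$, and each included edge is then independently given a uniformly random color from $[r]$. For $k>\ell\ge 1$ and $n$ divisible by $k-\ell$, an $\ell$-Hamilton cycle in a $k$-uniform hypergraph $H$ on $n$ vertices is a collection of $n/(k-\ell)$ edges of $H$ such that, for some cyclic ordering of the $n$ vertices, every edge consists of $k$ consecutive vertices and every pair of consecutive edges (in the natural cyclic ordering of the edges) intersects in precisely $\ell$ vertices. Equivalently, for some permutation $\pi$ of the vertices (indices modulo $n$), the edges are $E_\pi(i)=\{\pi((i-1)(k-\ell)+j): j\in[k]\}$ for $i\in[n/(k-\ell)]$. When $\ell=k-1$ it is called a tight Hamilton cycle. An $\ell$-Hamilton cycle in an edge-colored hypergraph is rainbow if its edges all have distinct colors. A colored hypergraph is rainbow $\ell$-Hamiltonian if it contains a rainbow $\ell$-Hamilton cycle. An event $\mathcal{E}_n$ occurs with high probability if $\lim_{n\to\infty}\Pr(\mathcal{E}_n)=1$. *)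

(* Defs.v *)
From HB Require Import structures.
From mathcomp Require Import all_boot all_order all_algebra all_fingroup.
From mathcomp Require Import all_classical all_reals all_analysis.

Set Implicit Arguments.
Unset Strict Implicit.
Unset Printing Implicit Defensive.

Import Order.TTheory GRing.Theory Num.Theory.
Import numFieldNormedType.Exports.

Local Open Scope classical_set_scope.
Local Open Scope ring_scope.

Definition kset (n k : nat) := {e : {set 'I_n} | #|e| == k}.

(* [H e = None] means that [e] is not an edge of [H]; [H e = Some a] means that
   [e] is an edge of colour [a]. *)
Definition colored_hypergraph (n k r : nat) := {ffun kset n k -> option 'I_r}.

Definition edges (n k r : nat) (H : colored_hypergraph n k r) :
  {set kset n k} := [set e | H e != None]%SET.

(* The window {pi ((i (k - l) + j) mod n) : 0 <= j < k}; vertices, positions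
   and windows are all numbered from 0. *)
Definition window (n k l : nat) (pi : {perm 'I_n}) (i : nat) : {set 'I_n} :=
  [set pi x | x : 'I_n & [exists j : 'I_k,
     nat_of_ord x == ((i * (k - l) + j) %% n)%N]]%SET.

Definition hamilton_cycle (n k l : nat) (C : {set kset n k}) : bool :=
  (#|C| == n %/ (k - l))%N &&
  [exists pi : {perm 'I_n},
     [set val e | e in C]%SET
       == [set window k l pi i | i : 'I_(n %/ (k - l))]%SET].

Definition rainbow (n k r : nat) (H : colored_hypergraph n k r)
  (C : {set kset n k}) : bool :=
  [forall e in C, forall f in C, (e != f) ==> (H e != H f)].

Definition rainbow_hamiltonian (n k r l : nat)
  (H : colored_hypergraph n k r) : bool :=
  [exists C : {set kset n k},
     [&& hamilton_cycle l C, C \subset edges H & rainbow H C]].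

(* Joint law of the two independent stages at one k-set: it is absent with
   probability 1 - p, and present with a given colour with probability p / r. *)
Definition kset_law (R : realType) (r : nat) (p : R) (a : option 'I_r) : R :=
  if a is Some _ then p * r%:R^-1 else 1 - p.

Definition prob (R : realType) (n k r : nat) (p : R)
  (A : pred (colored_hypergraph n k r)) : R :=
  \sum_(H : colored_hypergraph n k r | A H) \prod_(e : kset n k) kset_law p (H e).

Definition multiples_oo (d : nat) : set_system nat :=
  within [set n : nat | (d %| n)%N] \oo.

Definition whp (R : realType) (d k : nat) (r : nat -> nat) (p : nat -> R)
  (A : forall n, pred (colored_hypergraph n k (r n))) : Prop :=
  (fun n => prob (p n) (A n)) @ multiples_oo d --> (1 : R).

Definition rounding (R : realType) (x : R) (m : nat) : Prop :=
  m%:Z = Num.floor x \/ m%:Z = Num.ceil x.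

(* The direction in which c n is rounded may vary with n. *)
Definition admissible (R : realType) (d : nat) (c : R) (r : nat -> nat)
  (p : nat -> R) : Prop :=
  [/\ 1 / d%:R <= c,
      forall n : nat, (d %| n)%N -> rounding (c * n%:R) (r n) &
      forall n : nat, (d %| n)%N -> 0 <= p n <= 1].

(* Main.v *)
(** Count permutations pi of the vertices whose cycle is rainbow.  Two cycles
    sharing b edges are jointly rainbow with probability P^2 / Q_b, where P is the
    probability for one cycle and Q_b = prod_(i < b) (p / r) (r - i); so the first
    moment gives (i), and Chebyshev bounds the failure probability in (ii)-(iv) by
    the average of 1 / Q_b(tau) 1[b(tau) > 0] over permutations tau of positions, where
    b(tau) counts the windows, among the m = n / d with d = k - l, that tau maps to
    windows.  Moreover 1 / Q_b <= y^b for y = g / p,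
    where g = e always works and (iv) uses g^n close to r^n (r - n)! / r!; so it remains
    to sum y^b(tau).

    Read the preserved windows in increasing order.  A window disjoint from the
    previous ones has at most m images, an overlapping one at most k, and in a run
    of consecutive windows of a tight cycle only one.  Each newly covered vertex
    contributes a factor e / n, so a continued run costs (e / n)^d y up to a constant
    that is 1 for tight cycles, a short gap costs O(1 / n), and a long one
    O(n^(2 - l)) once its m positions are summed.  The total is a geometric series.
    Rotating pi, one may start after a gap of k windows; if there is no such gap,
    then b(tau) >= m / k and an exponential factor absorbs the loss at the seam. *)

Require Import Defs.
From HB Require Import structures.
From mathcomp Require Import all_boot all_order all_algebra all_fingroup.
From mathcomp Require Import all_classical all_reals all_analysis.
From mathcomp Require Import zify ring lra.

Set Implicit Arguments.
Unset Strict Implicit.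
Unset Printing Implicit Defensive.

Import Order.TTheory GRing.Theory Num.Theory.
Import numFieldNormedType.Exports.

Local Open Scope classical_set_scope.
Local Open Scope ring_scope.

(** * Factorials and exponentials *)

(** The count along a chain is linear while the windows are cyclic. Comparing a window with the one
    before it gives its new vertices correctly only if no window wraps round and meets window 0, so
    chains use indices below [m - k]. If the last [k] windows are not preserved, nothing is lost. In
    the dense case they are dropped, at a price polynomial in [n]. Replacing [y] by [y * a ^+ k]
    with [a > 1] gains [a ^+ (k * b)], at least [a ^+ m], which pays for them; the strict inequality
    [rho < 1] leaves room for such an [a].

    Put [z = (e / n)^d y], the cost of a continued run. The start of a chain has [m] images and the
    rotation [m] choices, so the final bound has the order [m^2 (e / n)^l z] of all long gaps
    together. For [l >= 3] this tends to 0 when [z] is bounded, and a constant [K] suffices; for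
    [l = 2] it is only of order [z], so [z] itself must tend to 0, whence [omega]. In (iv) [z] is
    only kept below a constant that may be arbitrarily close to 1, so a step within a run may not
    lose even a constant factor. *)

Lemma fact_ge_exp (R : realType) (n : nat) :
  n%:R ^+ n <= expR 1 ^+ n * n`!%:R :> R.
Proof.
case: n => [|n]; first by rewrite fact0 !expr0 mul1r.
rewrite -expRM_natl mulr1 -ler_pdivrMr ?ltr0n ?fact_gt0//.
apply: le_trans (expR_ge1Dxn n (ler0n R n.+1)).
by rewrite lerDr.
Qed.

(** The inductive step amounts to [(1 + 1 / (n + 1))^(n + 2) >= e], which is [ln (1 - x) <= - x] at
    [x = 1 / (n + 2)]. *)
Lemma fact_le_exp (R : realType) (n : nat) : (0 < n)%N ->
  n`!%:R * expR 1 ^+ n <= expR 1 * n%:R * n%:R ^+ n :> R.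
Proof.
elim: n => // n IH _; case: n IH => [|n] IH; first by rewrite factS fact0 !expr1 mul1r !mulr1.
have {}IH := IH isT.
set e := expR 1 in IH *; have e0 : 0 < e by exact: expR_gt0.
have key : e * n.+1%:R ^+ n.+2 <= n.+2%:R ^+ n.+2 :> R.
  rewrite -ler_pdivlMr ?exprn_gt0 ?ltr0n// -expr_div_n.
  have p0 : 0 < n.+2%:R / n.+1%:R :> R by rewrite divr_gt0.
  rewrite -{1}(lnK (x := n.+2%:R / n.+1%:R)) ?posrE// -expRM_natl ler_expR.
  have := @le_ln1Dx R (- (n.+2%:R^-1)).
  have -> : 1 + - n.+2%:R^-1 = (n.+2%:R / n.+1%:R)^-1 :> R.
    rewrite invf_div -[n.+2%:R]natr1.
    have x0 : 0 < n.+1%:R :> R by rewrite ltr0n.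
    by field; rewrite gt_eqF//; lra.
  rewrite lnV ?posrE// lerN2 => H.
  have : (n.+2%:R)^-1 <= ln (n.+2%:R / n.+1%:R) :> R.
    by apply: H; rewrite ltrN2 invf_lt1 ?ltr0n ?ltr1n.
  by rewrite -ler_pdivrMl ?ltr0n// mulr1.
rewrite factS natrM exprS.
have -> : n.+2%:R * (n.+1)`!%:R * (e * e ^+ n.+1)
        = (n.+2%:R * e) * ((n.+1)`!%:R * e ^+ n.+1) by ring.
apply: (@le_trans _ _ ((n.+2%:R * e) * (e * n.+1%:R * n.+1%:R ^+ n.+1))).
  by rewrite ler_wpM2l// mulr_ge0// ltW.
have -> : n.+2%:R * e * (e * n.+1%:R * n.+1%:R ^+ n.+1)
        = e * n.+2%:R * (e * n.+1%:R ^+ n.+2) by rewrite [X in _ = _ * (_ * X)]exprS; ring.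
by rewrite ler_wpM2l// mulr_ge0// ltW.
Qed.

(** Either the first [b] factors are all at most [g], or one of them exceeds [g]; then so does every
    later factor, and dropping those divides the product by at least [g ^+ (n - b)]. *)
Lemma prefix_prod_le (R : realFieldType) (a : nat -> R) (g : R) (n b : nat) :
  (forall i, (i < n)%N -> 0 < a i) ->
  (forall i j, (i <= j)%N -> (j < n)%N -> a i <= a j) ->
  0 < g -> \prod_(i < n) a i <= g ^+ n -> (b <= n)%N ->
  \prod_(i < b) a i <= g ^+ b.
Proof.
move=> a0 amono g0 tot bn.
have [ab|ab] := boolP [forall i : 'I_b, a i <= g].
  rewrite -[X in g ^+ X]card_ord -prodr_const; apply: ler_prod => i _.
  by rewrite (forallP ab i) ltW// a0// (leq_trans (ltn_ord i)).
have {ab} [i] : exists i : 'I_b, g < a i.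
  by move: ab; rewrite negb_forall => /existsP[i]; rewrite -ltNge => ?; exists i.
move=> gi.
have big : g ^+ (n - b) <= \prod_(b <= j < n) a j.
  rewrite -prodr_const_nat big_seq_cond [X in _ <= X]big_seq_cond.
  apply: ler_prod => j; rewrite andbT mem_index_iota => /andP[bj jn].
  by rewrite (ltW g0) (le_trans (ltW gi))// amono// (leq_trans (ltnW (ltn_ord i)) bj).
have spl : \prod_(i < n) a i = \prod_(i < b) a i * \prod_(b <= j < n) a j.
  by rewrite -!(big_mkord xpredT) (big_cat_nat (n := b)).
have pb : 0 <= \prod_(i < b) a i.
  by apply: prodr_ge0 => j _; rewrite ltW// a0// (leq_trans (ltn_ord j)).
have gnb : 0 < g ^+ (n - b) by rewrite exprn_gt0.
rewrite -(ler_pM2r gnb) -exprD subnKC//.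
apply: le_trans tot; rewrite spl; exact: ler_wpM2l.
Qed.

Lemma prod_ffact (R : realFieldType) (r b : nat) :
  \prod_(i < b) ((r - i)%:R : R) = (r ^_ b)%:R.
Proof. by rewrite ffact_prod -natr_prod. Qed.

(** The factors [r / (r - i)] increase, so a constant [g] that is right for a whole cycle is right
    for every partial overlap. *)
Lemma expr_le_ffact (R : realFieldType) (g : R) (r n b : nat) :
  0 < g -> (n <= r)%N -> r%:R ^+ n <= g ^+ n * (r ^_ n)%:R -> (b <= n)%N ->
  r%:R ^+ b <= g ^+ b * (r ^_ b)%:R.
Proof.
move=> g0 nr H bn.
have E c : (c <= n)%N -> \prod_(i < c) (r%:R / (r - i)%:R : R) = r%:R ^+ c / (r ^_ c)%:R.
  by move=> _; rewrite big_split/= prodr_const card_ord prodfV prod_ffact.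
have F c : (c <= n)%N -> 0 < (r ^_ c)%:R :> R.
  by move=> cn; rewrite ltr0n ffact_gt0 (leq_trans cn).
rewrite -ler_pdivrMr ?F// -E//.
apply: (@prefix_prod_le _ (fun i => r%:R / (r - i)%:R) g n b) => //.
- move=> i ni; rewrite divr_gt0// ltr0n; lia.
- move=> i j ij jn; rewrite ler_wpM2l// lef_pV2 ?posrE ?ltr0n ?ler_nat; lia.
- by rewrite E// ler_pdivrMr ?F.
Qed.

Lemma expr_le_ffact_expR (R : realType) (r b : nat) : (b <= r)%N ->
  r%:R ^+ b <= expR 1 ^+ b * (r ^_ b)%:R :> R.
Proof.
move=> br; apply: (@expr_le_ffact _ _ _ r) => //; rewrite ?expR_gt0//.
by rewrite ffactnn fact_ge_exp.
Qed.

Lemma fact_sub_le (R : realType) (n j : nat) : (0 < n)%N -> (j <= n)%N ->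
  (n - j)`!%:R <= n`!%:R * (expR 1 / n%:R) ^+ j :> R.
Proof.
move=> n0 jn; rewrite -(ffact_fact jn) natrM expr_div_n.
have H := @expr_le_ffact_expR R n j jn.
set F := (n ^_ j)%:R in H *; set G := (n - j)`!%:R.
have -> : F * G * (expR 1 ^+ j / n%:R ^+ j) = G * (expR 1 ^+ j * F / n%:R ^+ j) by ring.
by rewrite ler_peMr// ler_pdivlMr ?exprn_gt0 ?ltr0n// mul1r.
Qed.

(** The function [x ln (1 + m / x)] is concave and its tangent at [b] has slope [L - m / (b + m)],
    between 0 and [L]; moving up by at most 1 costs at most [L]. This absorbs the rounding of the
    number of colours. *)
Lemma mul_ln1D_le (R : realType) (m a b : R) : 0 <= m -> 0 < a -> 0 < b ->
  a - b <= 1 -> a * ln (1 + m / a) <= b * ln (1 + m / b) + ln (1 + m / b).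
Proof.
move=> m0 a0 b0 ab.
set L := ln (1 + m / b).
have am0 : 0 < a + m by rewrite ltr_wpDr.
have bm0 : 0 < b + m by rewrite ltr_wpDr.
have pb : 0 < 1 + m / b by rewrite ltr_wpDr// divr_ge0// ltW.
have pa : 0 < 1 + m / a by rewrite ltr_wpDr// divr_ge0// ltW.
have L1 : m / (b + m) <= L.
  rewrite -[L]opprK -lnV ?posrE// lerNr.
  have -> : (1 + m / b)^-1 = 1 + - (m / (b + m)).
    by field; rewrite ?gt_eqF//=.
  apply: le_ln1Dx; rewrite ltrN2 ltr_pdivrMr// mul1r; lra.
have mb0 : 0 <= m / (b + m) by rewrite divr_ge0// ltW.
have : ln (1 + m / a) - L <= (b - a) * m / (a * (b + m)).
  rewrite -ln_div ?posrE//.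
  have -> : (1 + m / a) / (1 + m / b) = 1 + (b - a) * m / (a * (b + m)).
    by field; rewrite ?gt_eqF//=.
  apply: le_ln1Dx.
  have -> : (b - a) * m / (a * (b + m)) = (b / a) * ((a + m) / (b + m)) - 1.
    by field; rewrite ?gt_eqF//=.
  by rewrite -[ltLHS]add0r ltrD2r mulr_gt0// divr_gt0.
rewrite -(ler_pM2l a0).
have -> : a * ((b - a) * m / (a * (b + m))) = (b - a) * (m / (b + m)).
  by field; rewrite ?gt_eqF//=.
move=> H.
suff : (a - b) * (L - m / (b + m)) <= L by lra.
have [ab0|ab0] := leP a b.
  by rewrite (@le_trans _ _ 0) ?(le_trans mb0)// mulr_le0_ge0 ?subr_le0 ?subr_ge0.
apply: (@le_trans _ _ (L - m / (b + m))); last lra.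
by rewrite ler_piMl ?subr_ge0.
Qed.

Lemma exprn_poly_bound (R : realType) (a : R) (D : nat) : 1 < a ->
  exists2 C : R, 0 < C & forall m : nat, m%:R ^+ D <= C * a ^+ m.
Proof.
move=> a1; have la : 0 < ln a by rewrite ln_gt0.
have a0 : 0 < a by rewrite (lt_trans ltr01).
case: D => [|D].
  by exists 1 => // m; rewrite expr0 mul1r exprn_ege1// ltW.
exists (D.+1`!%:R / ln a ^+ D.+1).
  by rewrite divr_gt0 ?exprn_gt0// ltr0n fact_gt0.
move=> m; rewrite -[X in X ^+ m]lnK ?posrE// -expRM_natl.
have xge0 : 0 <= m%:R * ln a by rewrite mulr_ge0// ltW.
have := expR_ge1Dxn D xge0; set E := expR _ => H.
have {}H : (m%:R * ln a) ^+ D.+1 / D.+1`!%:R <= E by apply: le_trans H; rewrite lerDr.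
rewrite mulrAC ler_pdivlMr ?exprn_gt0// -exprMn.
by rewrite [leRHS]mulrC -ler_pdivrMr// ltr0n fact_gt0.
Qed.

(** * Independent colours *)

Definition mass (R : realType) (I A : finType) (law : A -> R) (H : {ffun I -> A}) : R :=
  \prod_(e : I) law (H e).

Definition update (I A : finType) (H : {ffun I -> A}) (e : I) (a : A) : {ffun I -> A} :=
  [ffun x => if x == e then a else H x].

Lemma sum_mass (R : realType) (I A : finType) (law : A -> R) :
  \sum_a law a = 1 -> \sum_(H : {ffun I -> A}) mass law H = 1.
Proof.
move=> l1; rewrite -(bigA_distr_bigA (fun (_ : I) a => law a)) big1// => i _.
Qed.

(** Multiplied through because [law (H e)] may vanish. *)
Lemma mass_update (R : realType) (I A : finType) (law : A -> R)
    (H : {ffun I -> A}) (e : I) (a : A) :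
  mass law (update H e a) * law (H e) = mass law H * law a.
Proof.
rewrite /mass (bigD1 e)//= [X in _ = X * _](bigD1 e)//= ffunE eqxx.
rewrite (eq_bigr (fun i => law (H i))) => [|i /negPf ie]; first by ring.
by rewrite ffunE ie.
Qed.

(* Exchanging (H, a) with (update H e a, H e) preserves mass law H * law a. *)
Lemma resample (R : realType) (I A : finType) (law : A -> R) (e : I)
    (F : {ffun I -> A} -> A -> R) :
  \sum_a law a = 1 -> (forall H a b, F (update H e a) b = F H b) ->
  \sum_H mass law H * F H (H e) = \sum_H mass law H * \sum_a law a * F H a.
Proof.
move=> l1 Fe.
pose phi (u : {ffun I -> A} * A) := (update u.1 e u.2, u.1 e).
have phiK : involutive phi.
  move=> [H a]; rewrite /phi/=; congr (_, _); last by rewrite ffunE eqxx.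
  by apply/ffunP => x; rewrite !ffunE; case: eqP => [->|].
transitivity (\sum_(u : {ffun I -> A} * A) mass law u.1 * law u.2 * F u.1 (u.1 e)).
  rewrite -(pair_bigA _ (fun H a => mass law H * law a * F H (H e)))/=.
  apply: eq_bigr => H _.
  by rewrite -mulr_suml -mulr_sumr l1 mulr1.
rewrite (reindex_inj (inv_inj phiK))/=.
transitivity (\sum_(u : {ffun I -> A} * A) mass law u.1 * law u.2 * F u.1 u.2).
  apply: eq_bigr => -[H a] _ /=.
  by rewrite mass_update Fe ffunE eqxx.
rewrite -(pair_bigA _ (fun H a => mass law H * law a * F H a))/=.
apply: eq_bigr => H _; rewrite mulr_sumr.
by apply: eq_bigr => a _; rewrite mulrA.
Qed.

(** Listing [None] lets one uniqueness test say both that all the sets are present and that their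
    colours differ. *)
Definition rainbow_seq (I A : finType) (H : {ffun I -> option A}) (s : seq I) : bool :=
  uniq (None :: map H s).

Lemma rainbow_seq_cons (I A : finType) (H : {ffun I -> option A}) (e : I) (s : seq I) :
  rainbow_seq H (e :: s) = [&& H e \notin None :: map H s & rainbow_seq H s].
Proof. by rewrite /rainbow_seq/= !inE !negb_or eq_sym; do !case: (_ \notin _); case: eqP. Qed.

Lemma map_update (I A : finType) (H : {ffun I -> option A}) (e : I)
    (a : option A) (s : seq I) :
  e \notin s -> map (update H e a) s = map H s.
Proof.
move=> es; apply/eq_in_map => x xs; rewrite ffunE.
by case: eqP => // xe; rewrite -xe xs in es.
Qed.

Lemma sum_kset_law (R : realType) (r : nat) (p : R) : (0 < r)%N ->
  \sum_(a : option 'I_r) kset_law p a = 1.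
Proof.
move=> r0; rewrite (bigD1 None)//= (eq_bigr (fun=> p / r%:R)) => [|[a|]]//.
rewrite sumr_const cardC1 card_option card_ord -[X in _ + X]mulr_natr.
by rewrite divfK ?subrK// pnatr_eq0 -lt0n.
Qed.

Lemma kset_law_ge0 (R : realType) (r : nat) (p : R) (a : option 'I_r) :
  0 <= p <= 1 -> 0 <= kset_law p a.
Proof.
by move=> /andP[p0 p1]; case: a => [a|]/=; rewrite ?subr_ge0// mulr_ge0.
Qed.

Lemma sum_kset_law_fresh (R : realType) (r : nat) (p : R) (s : seq (option 'I_r)) :
  uniq (None :: s) ->
  \sum_a kset_law p a * (a \notin None :: s)%:R = p / r%:R * (r - size s)%:R.
Proof.
move=> us.
transitivity (\sum_(a | a \notin None :: s) p / r%:R).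
  rewrite [RHS]big_mkcond/=; apply: eq_bigr => -[a|] _ /=; last first.
    by rewrite mulr0.
  by case: (_ \notin _); rewrite ?mulr1 ?mulr0.
rewrite sumr_const -[LHS]mulr_natr; congr (_ * _%:R).
have := cardC (mem (None :: s)); rewrite card_option card_ord (card_uniqP us)/=.
by move=> H; rewrite -[LHS](addKn (size s).+1) H subSS.
Qed.

(** The entries of [s2] are exposed one at a time, each having to avoid the colours already on the
    list. The event [f] does not see them. With [f] true and [s1] empty this gives the probability
    of one cycle; with [f] the first cycle being rainbow and [s1] the common edges, that of a
    pair. *)
Lemma sum_mass_rainbow_cat (R : realType) (I : finType) (r : nat) (p : R)
    (f : pred {ffun I -> option 'I_r}) (s1 s2 : seq I) :
  (0 < r)%N -> uniq (s2 ++ s1) ->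
  (forall H, f H -> rainbow_seq H s1) ->
  (forall H e a, e \in s2 -> f (update H e a) = f H) ->
  \sum_(H : {ffun I -> option 'I_r}) mass (kset_law p) H * (f H && rainbow_seq H (s2 ++ s1))%:R =
  (\prod_(i < size s2) (p / r%:R * (r - (size s1 + i))%:R)) *
  \sum_(H : {ffun I -> option 'I_r}) mass (kset_law p) H * (f H)%:R.
Proof.
move=> r0; elim: s2 => [|e s2 IH]/=.
  move=> _ fs1 _; rewrite big_ord0 mul1r; apply: eq_bigr => H _; congr (_ * _%:R).
  by rewrite andb_idr// => /fs1.
move=> /andP[es u] fs1 fe.
rewrite big_ord_recr/= mulrAC -IH//; last first.
  by move=> H e' a e's; apply: fe; rewrite inE e's orbT.
(* The value at [e] is split off as a separate argument: what remains ignores [H e], so that entry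
   may be resampled. *)
pose F (H : {ffun I -> option 'I_r}) a : R :=
  ((f H && rainbow_seq H (s2 ++ s1)) && (a \notin None :: map H (s2 ++ s1)))%:R.
have := @resample R I _ (kset_law p) e F (sum_kset_law p r0).
have Fe H a b : F (update H e a) b = F H b.
  by rewrite /F fe ?mem_head// /rainbow_seq !map_update.
move=> /(_ Fe) H1.
transitivity (\sum_(H : {ffun I -> option 'I_r}) mass (kset_law p) H * F H (H e)).
  apply: eq_bigr => H _; congr (_ * _%:R).
  rewrite rainbow_seq_cons; congr nat_of_bool.
  by case: (f H) => //=; rewrite andbC.
rewrite {}H1 mulr_suml; apply: eq_bigr => H _.
rewrite -[RHS]mulrA; congr (_ * _).
rewrite /F; case: (f H) => /=; last by rewrite mul0r big1// => a _; rewrite mulr0.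
case: (boolP (rainbow_seq H _)) => ru /=; last first.
  by rewrite mul0r big1// => a _; rewrite mulr0.
rewrite mul1r; by rewrite sum_kset_law_fresh// size_map size_cat addnC.
Qed.

Definition rainbow_prob (R : realType) (r : nat) (p : R) (b : nat) : R :=
  \prod_(i < b) (p / r%:R * (r - i)%:R).

Lemma rainbow_probE (R : realType) (r : nat) (p : R) (b : nat) :
  rainbow_prob r p b = (p / r%:R) ^+ b * (r ^_ b)%:R.
Proof. by rewrite /rainbow_prob big_split/= prodr_const card_ord prod_ffact. Qed.

Lemma rainbow_prob_gt0 (R : realType) (r : nat) (p : R) (b : nat) :
  0 < p -> (b <= r)%N -> 0 < rainbow_prob r p b.
Proof.
move=> p0 br; apply: prodr_gt0 => i _; have := ltn_ord i => ib.
by rewrite mulr_gt0 ?divr_gt0 ?ltr0n//; lia.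
Qed.

Definition rainbow_in (I A : finType) (C : {set I}) (H : {ffun I -> option A}) :=
  rainbow_seq H (enum C).

Lemma rainbow_seq_perm (I A : finType) (H : {ffun I -> option A}) (s t : seq I) :
  perm_eq s t -> rainbow_seq H s = rainbow_seq H t.
Proof. by move=> st; apply: perm_uniq; rewrite perm_cons perm_map. Qed.

Lemma rainbow_inE (n k r : nat) (C : {set kset n k}) (H : colored_hypergraph n k r) :
  rainbow_in C H = (C \subset edges H) && rainbow H C.
Proof.
rewrite /rainbow_in /rainbow_seq/=; congr andb.
- apply/idP/fintype.subsetP => [N e eC|sub].
    rewrite inE; apply: contraNneq N => He.
    by apply/mapP; exists e; rewrite ?mem_enum.
  apply/mapP => -[e]; rewrite mem_enum => /sub; rewrite inE => /eqP + /esym.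
  by [].
- apply/(dinjectiveP H (mem C))/idP => [inj|rb e f eC fC Hef].
    apply/forall_inP => e eC; apply/forall_inP => f fC; apply/implyP.
    by apply: contra_neq; apply: inj.
  apply/eqP; apply: contraPT (Hef) => ef.
  by apply/eqP; move/forall_inP/(_ e eC)/forall_inP/(_ f fC)/implyP/(_ ef): rb.
Qed.

Lemma prob_rainbow_in (R : realType) (I : finType) (r : nat) (p : R) (C : {set I}) :
  (0 < r)%N ->
  \sum_(H : {ffun I -> option 'I_r}) mass (kset_law p) H * (rainbow_in C H)%:R
    = rainbow_prob r p #|C|.
Proof.
move=> r0.
have := @sum_mass_rainbow_cat R I r p xpredT [::] (enum C) r0.
rewrite cats0 enum_uniq => /(_ isT); rewrite /= => -> //.
rewrite -cardE; under [X in _ * X]eq_bigr do rewrite mulr1.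
by rewrite sum_mass ?mulr1 ?sum_kset_law.
Qed.

(** Once [C] is rainbow, the edges of [D] outside [C] need only avoid colours used within [D]; the
    colours on [C] alone are irrelevant to them. Their factors are those of [rainbow_prob r p #|D|]
    after the first [#|C :&: D|]. *)
Lemma prob_rainbow_in2 (R : realType) (I : finType) (r : nat) (p : R) (C D : {set I}) :
  (0 < r)%N ->
  (\sum_(H : {ffun I -> option 'I_r}) mass (kset_law p) H * (rainbow_in C H && rainbow_in D H)%:R)
     * rainbow_prob r p #|C :&: D|
  = rainbow_prob r p #|C| * rainbow_prob r p #|D|.
Proof.
move=> r0; set s1 := enum (C :&: D); set s2 := enum (D :\: C).
have pD : perm_eq (enum D) (s2 ++ s1).
  apply: uniq_perm; rewrite ?enum_uniq//.
    rewrite cat_uniq !enum_uniq/= andbT; apply/hasPn => x.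
    by rewrite !mem_enum !inE => /andP[->].
  move=> x; rewrite mem_cat !mem_enum !inE.
  by case: (x \in C); case: (x \in D).
have u : uniq (s2 ++ s1) by rewrite -(perm_uniq pD) enum_uniq.
have := @sum_mass_rainbow_cat R I r p (rainbow_in C) s1 s2 r0 u.
rewrite prob_rainbow_in// => E.
under eq_bigr do rewrite {2}/rainbow_in (rainbow_seq_perm _ pD).
rewrite E => [|H|H e a].
- rewrite [X in X * _]mulrC -mulrA; congr (_ * _).
  have -> : #|D| = (size s1 + size s2)%N.
    by rewrite -cardE -cardE -(cardsID C D) finset.setIC.
  rewrite /rainbow_prob big_split_ord/= mulrC; congr (_ * _).
  by rewrite cardE.
- rewrite /rainbow_in /rainbow_seq/= => /andP[N U]; apply/andP; split.
    apply: contra N => /mapP[e]; rewrite mem_enum inE => /andP[eC _] He.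
    by apply/mapP; exists e; rewrite ?mem_enum.
  apply/(dinjectiveP H (mem (C :&: D))) => e f.
  rewrite !inE => /andP[eC _] /andP[fC _].
  by move/(dinjectiveP H (mem C)): U => inj; apply: inj.
- rewrite mem_enum inE => /andP[eC _].
  by rewrite /rainbow_in /rainbow_seq map_update// mem_enum.
Qed.

Lemma first_moment (R : realType) (I J : finType) (r m : nat) (p : R) (C : J -> {set I}) :
  (0 < r)%N -> 0 <= p <= 1 -> (forall j, #|C j| = m) ->
  \sum_(H : {ffun I -> option 'I_r})
      mass (kset_law p) H * [exists j, rainbow_in (C j) H]%:R
    <= #|J|%:R * rainbow_prob r p m.
Proof.
move=> r0 p01 Cm.
apply: (@le_trans _ _ (\sum_(H : {ffun I -> option 'I_r}) mass (kset_law p) H *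
          \sum_j (rainbow_in (C j) H)%:R)).
  apply: ler_sum => H _; rewrite ler_wpM2l//.
    by apply: prodr_ge0 => e _; exact: kset_law_ge0.
  case: existsP => [[j Hj]|_]; last by apply: sumr_ge0.
  by rewrite (bigD1 j)//= Hj lerDl sumr_ge0.
under eq_bigr do rewrite mulr_sumr.
rewrite exchange_big/=; under eq_bigr do rewrite prob_rainbow_in// Cm.
by rewrite sumr_const -[leLHS]mulr_natl.
Qed.

(** Chebyshev's inequality at 0. A disjoint pair contributes the same to the second moment and to
    the squared mean, so only intersecting pairs survive in the variance. *)
Lemma second_moment (R : realType) (I J : finType) (r m : nat) (p : R) (C : J -> {set I}) :
  (0 < r)%N -> 0 < p <= 1 -> (m <= r)%N -> (0 < #|J|)%N -> (forall j, #|C j| = m) ->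
  \sum_(H : {ffun I -> option 'I_r}) mass (kset_law p) H * (~~ [exists j, rainbow_in (C j) H])%:R
    <= (\sum_i \sum_j (C i :&: C j != finset.set0)%:R / rainbow_prob r p #|C i :&: C j|)
         / #|J|%:R ^+ 2.
Proof.
move=> r0 /andP[p0 p1] mr J0 Cm.
have p01 : 0 <= p <= 1 by rewrite p1 ltW.
pose w (H : {ffun I -> option 'I_r}) := mass (kset_law p) H.
have w0 H : 0 <= w H by apply: prodr_ge0 => e _; exact: kset_law_ge0.
have w1 : \sum_(H : {ffun I -> option 'I_r}) w H = 1 by rewrite sum_mass// sum_kset_law.
pose X (H : {ffun I -> option 'I_r}) : R := \sum_j (rainbow_in (C j) H)%:R.
pose Q := rainbow_prob r p m.
have Q0 : 0 < Q by exact: rainbow_prob_gt0.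
have N0 : 0 < #|J|%:R :> R by rewrite ltr0n.
pose mu := #|J|%:R * Q.
have EX : \sum_(H : {ffun I -> option 'I_r}) w H * X H = mu.
  under eq_bigr do rewrite mulr_sumr.
  rewrite exchange_big/=; under eq_bigr do rewrite prob_rainbow_in// Cm.
  by rewrite sumr_const -[LHS]mulr_natl.
have Qb i j : 0 < rainbow_prob r p #|C i :&: C j|.
  apply: rainbow_prob_gt0 => //; apply: leq_trans mr; rewrite -(Cm i).
  exact: subset_leq_card (subsetIl _ _).
have EXX : \sum_(H : {ffun I -> option 'I_r}) w H * X H ^+ 2 =
    Q ^+ 2 * \sum_i \sum_j (rainbow_prob r p #|C i :&: C j|)^-1.
  transitivity (\sum_(H : {ffun I -> option 'I_r}) \sum_i \sum_j
      w H * (rainbow_in (C i) H && rainbow_in (C j) H)%:R).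
    apply: eq_bigr => H _; rewrite expr2 /X big_distrlr/= mulr_sumr.
    apply: eq_bigr => i _; rewrite mulr_sumr; apply: eq_bigr => j _.
    by rewrite -natrM mulnb.
  rewrite exchange_big mulr_sumr; apply: eq_bigr => i _.
  rewrite exchange_big mulr_sumr; apply: eq_bigr => j _ /=.
  apply: (mulIf (lt0r_neq0 (Qb i j))).
  by rewrite prob_rainbow_in2// !Cm mulfVK ?lt0r_neq0// expr2.
have mu0 : 0 < mu by rewrite mulr_gt0.
have key : mu ^+ 2 * (\sum_H w H * (~~ [exists j, rainbow_in (C j) H])%:R)
    <= \sum_(H : {ffun I -> option 'I_r}) w H * (X H - mu) ^+ 2.
  rewrite mulr_sumr; apply: ler_sum => H _; rewrite mulrCA ler_wpM2l//.
  case: existsP => /= [_|N]; first by rewrite mulr0 sqr_ge0.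
  rewrite mulr1 /X big1 ?sub0r ?sqrrN// => j _.
  by case: (boolP (rainbow_in (C j) H)) => // Hj; case: N; exists j.
have var : \sum_H w H * (X H - mu) ^+ 2 = \sum_H w H * X H ^+ 2 - mu ^+ 2.
  transitivity (\sum_H (w H * X H ^+ 2 +
      ((- (mu *+ 2)) * (w H * X H) + mu ^+ 2 * w H))).
    by apply: eq_bigr => H _; ring.
  by rewrite !big_split/= -!mulr_sumr EX w1; ring.
rewrite ler_pdivlMr ?exprn_gt0// -(ler_pM2l (exprn_gt0 2 Q0)).
have -> : forall Y, Q ^+ 2 * (Y * #|J|%:R ^+ 2) = mu ^+ 2 * Y.
  by move=> Y; rewrite /mu; ring.
apply: (le_trans key); rewrite var EXX.
(* Writing the squared mean as a sum over pairs allows the variance to be compared pair by pair. *)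
have -> : mu ^+ 2 = Q ^+ 2 * \sum_(i : J) \sum_(j : J) 1.
  under eq_bigr do rewrite sumr_const.
  by rewrite sumr_const -mulr_natl /mu; ring.
rewrite -mulrBr ler_pM2l ?exprn_gt0// -sumrB ler_sum// => i _.
rewrite -sumrB ler_sum// => j _.
case: eqVneq => [->|_] /=; last by rewrite mul1r gerBl.
by rewrite cards0 /rainbow_prob big_ord0 invr1 subrr mul0r.
Qed.

(** * Windows and the permutations preserving them *)

(** The positions that a window occupies, without [pi]. The overlap of two cycles then depends only
    on the quotient of their permutations. *)
Definition block (n d k i : nat) : {set 'I_n} :=
  [set x : 'I_n | [exists j : 'I_k, nat_of_ord x == ((i * d + j) %% n)%N]]%SET.

Lemma windowE (n k l : nat) (pi : {perm 'I_n}) (i : nat) :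
  window k l pi i = (pi @: block n (k - l) k i)%SET.
Proof. by rewrite /window /block; congr (_ @: _)%SET; apply/setP => x; rewrite !inE. Qed.

Lemma in_block (n d k i : nat) (x : 'I_n) :
  reflect (exists2 j, (j < k)%N & nat_of_ord x = (i * d + j) %% n)%N (x \in block n d k i).
Proof.
rewrite inE; apply: (iffP existsP) => [[j /eqP]|[j jk ->]]; first by exists j.
by exists (Ordinal jk).
Qed.

Lemma block_addm (n d k m i : nat) : (n = m * d)%N ->
  block n d k (i + m) = block n d k i.
Proof.
move=> nE; apply/setP => x; rewrite !inE; apply: eq_existsb => j.
by rewrite mulnDl -nE addnAC modnDr.
Qed.

Lemma in_block_small (n d k i : nat) (x : 'I_n) : (i * d + k <= n)%N ->
  (x \in block n d k i) = (i * d <= x < i * d + k)%N.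
Proof.
move=> ikn; apply/in_block/idP => [[j jk ->]|/andP[ix xi]].
  by rewrite modn_small; lia.
exists (x - i * d)%N; first lia.
by rewrite modn_small; lia.
Qed.

Lemma eqn_mod_small (n a x y : nat) : (x < n)%N -> (y < n)%N ->
  a + x = a + y %[mod n] -> x = y.
Proof.
by move=> xn yn /eqP; rewrite eqn_modDl !modn_small// => /eqP.
Qed.

Lemma card_block (n d k i : nat) : (k <= n)%N -> #|block n d k i| = k.
Proof.
move=> kn; have [n00|n0] := posnP n.
  subst n; move: kn; rewrite leqn0 => /eqP ->.
  by apply: eq_card0 => -[].
pose f (j : 'I_k) : 'I_n := Ordinal (ltn_pmod (i * d + j) n0).
have -> : block n d k i = [set f j | j : 'I_k]%SET.
  apply/setP => x; apply/in_block/imsetP => [[j jk E]|[j _ ->]].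
    by exists (Ordinal jk) => //; apply/val_inj.
  by exists j.
rewrite card_imset ?card_ord// => j j' /(congr1 val)/= /eqn_mod_small E.
by apply/val_inj/E; apply: leq_trans kn.
Qed.

(** If the first point of block [i] is number [s] of block [j], then its last point is number
    [s + k - 1], without wrap-around since [2 * k <= n]; this is below [k] only for [s = 0]. *)
Lemma block_inj (n d k m i j : nat) : (0 < d)%N -> (n = m * d)%N -> (0 < k)%N ->
  (2 * k <= n)%N -> (i < m)%N -> (j < m)%N -> block n d k i = block n d k j -> i = j.
Proof.
move=> d0 nE k0 kn im jm E.
have n0 : (0 < n)%N by lia.
have mem t : (t < k)%N -> exists2 s, (s < k)%N & (i * d + t = j * d + s %[mod n])%N.
  move=> tk; have : Ordinal (ltn_pmod (i * d + t) n0) \in block n d k i.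
    by apply/in_block; exists t.
  by rewrite E => /in_block[s sk /= Hs]; exists s.
have [s sk Hs] := mem 0%N k0; have [t tk Ht] := mem k.-1 ltac:(lia).
have : (j * d + t = j * d + (s + k.-1) %[mod n])%N.
  by rewrite -Ht addnA -[RHS]modnDml -Hs modnDml addn0.
move/eqn_mod_small => st.
have s0 : s = 0%N by have := st ltac:(lia) ltac:(lia); lia.
move: Hs; rewrite s0 !addn0 nE !modn_small ?ltn_pmul2r//.
by move/eqP; rewrite eqn_pmul2r// => /eqP.
Qed.

(** The offset of [y] in a block, one of [k] values, determines the block. *)
Lemma card_blocks_through (n d k m : nat) (y : 'I_n) : (0 < d)%N -> (n = m * d)%N ->
  (#|[set j : 'I_m | y \in block n d k j]%SET| <= k)%N.
Proof.
move=> d0 nE.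
have [->|k0] := posnP k.
  rewrite leqn0 cards_eq0; apply/eqP/setP => j; rewrite !inE.
  by apply/existsP => -[[]].
pose f (j : 'I_m) : 'I_k :=
  odflt (Ordinal k0) [pick t : 'I_k | nat_of_ord y == (j * d + t) %% n]%N.
suff fi : {in [set j : 'I_m | y \in block n d k j]%SET &, injective f}.
  by rewrite -(card_in_imset fi) -[leqRHS]card_ord max_card.
move=> i j; rewrite !inE /f => /existsP[s Hs] /existsP[t Ht].
case: pickP => [s'|/(_ s)]; last by rewrite Hs.
case: pickP => [t'|/(_ t)]; last by rewrite Ht.
move=> /eqP Et /eqP Es /= st; rewrite st Et in Es.
apply/val_inj/eqP; rewrite -(eqn_pmul2r d0); apply/eqP.
have := Es; rewrite ![(_ * d + _)%N]addnC => /eqn_mod_small -> //.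
  by rewrite nE ltn_pmul2r.
by rewrite nE ltn_pmul2r.
Qed.

(* Both blocks are neighbours of block i, and the point of block i missing from Z is
   its first or its last one, which tells on which side they lie. *)
Lemma tight_block_unique (n k i j j' : nat) (Z : {set 'I_n}) : (1 < k)%N ->
  (2 * k <= n)%N -> (i < n)%N -> (j < n)%N -> (j' < n)%N -> #|Z| = k.-1 ->
  Z \subset block n 1 k i -> Z \subset block n 1 k j -> Z \subset block n 1 k j' ->
  j != i -> j' != i -> j = j'.
Proof.
move=> k1 kn ilt jlt j'lt cZ Zi Zj Zj' ji j'i.
have n0 : (0 < n)%N by lia.
have n1 : (n = n * 1)%N by rewrite muln1.
have cb a : #|block n 1 k a| = k by apply: card_block; lia.
have /cards1P[z zE] : #|block n 1 k i :\: Z| == 1%N.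
  by rewrite cardsD cb (finset.setIidPr Zi) cZ; lia.
have zN a : (a < n)%N -> Z \subset block n 1 k a -> a != i -> z \notin block n 1 k a.
  move=> an Za; apply: contra => za; apply/eqP.
  apply: (@block_inj n 1 k n a i) => //; first lia.
  apply/esym/eqP; rewrite eqEcard !cb leqnn andbT; apply/fintype.subsetP => x xi.
  have [/(fintype.subsetP Za)//|xZ] := boolP (x \in Z).
  have : x \in block n 1 k i :\: Z by rewrite inE xZ xi.
  by rewrite zE inE => /eqP ->.
have : z \in block n 1 k i :\: Z by rewrite zE inE.
rewrite inE => /andP[_ /in_block[t tk]]; rewrite muln1 => zt.
have inZ s : (s < k)%N -> s != t -> Ordinal (ltn_pmod (i + s) n0) \in Z.
  move=> sk st; set x := Ordinal _.
  have [//|xZ] := boolP (x \in Z).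
  have : x \in block n 1 k i :\: Z.
    by rewrite inE xZ; apply/in_block; exists s; rewrite ?muln1.
  rewrite zE inE => /eqP/(congr1 val) /=; rewrite zt => /eqn_mod_small E.
  by rewrite E ?eqxx in st; lia.
have inb a s : Z \subset block n 1 k a -> (s < k)%N -> s != t ->
    exists2 u, (u < k)%N & (i + s = a + u %[mod n])%N.
  move=> Za sk st; have /in_block[u uk /= E] := fintype.subsetP Za _ (inZ s sk st).
  by exists u => //; rewrite E muln1.
have ninb a u : (a < n)%N -> Z \subset block n 1 k a -> a != i -> (u < k)%N ->
    (i + t = a + u %[mod n])%N -> False.
  move=> an Za ai uk E; have /in_block := zN a an Za ai; apply.
  by exists u => //; rewrite muln1 zt.
have [t0|t0] := eqVneq t 0%N.
  have nxt a : (a < n)%N -> Z \subset block n 1 k a -> a != i -> (a = i + 1 %[mod n])%N.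
    move=> an Za ai; have [||[|u] uk E] := inb a 1%N Za; rewrite ?t0//.
      by rewrite E addn0.
    case: (ninb a u) => //; first lia.
    apply/eqP; rewrite -(eqn_modDr 1) t0 addn0 E -addnA addn1.
    by rewrite eqxx.
  by have := nxt j jlt Zj ji; rewrite -(nxt j' j'lt Zj' j'i) !modn_small.
have [tk1|tk1] := eqVneq t k.-1.
  have prv a : (a < n)%N -> Z \subset block n 1 k a -> a != i -> (a + 1 = i %[mod n])%N.
    move=> an Za ai; have [||u uk E] := inb a k.-2 Za; rewrite ?tk1; try lia.
    have [uk1|uk1] := ltnP u.+1 k.
      case: (ninb a u.+1) => //; rewrite tk1.
      have -> : (i + k.-1 = i + k.-2 + 1)%N by lia.
      by rewrite -modnDml E modnDml -addnA addn1.
    apply/eqP; rewrite -(eqn_modDr k.-2) E.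
    by apply/eqP; congr (_ %% _)%N; lia.
  have := prv j jlt Zj ji; rewrite -(prv j' j'lt Zj' j'i) => /eqP.
  by rewrite eqn_modDr !modn_small// => /eqP.
(* If the missing point were interior, both ends of block [i] would lie in [Z], hence in block [j],
   forcing [j = i]. *)
have [||s sk E] := inb j 0%N Zj; [lia | by rewrite eq_sym |].
have [||s' s'k E'] := inb j k.-1 Zj; [lia | by rewrite eq_sym |].
have : (j + s' = j + (s + k.-1) %[mod n])%N.
  by rewrite -E' addnA -[RHS]modnDml -E modnDml addn0.
move/eqn_mod_small => st.
have s0 : s = 0%N.
  by clear -st sk s'k kn k1; have := st ltac:(lia) ltac:(lia); lia.
by move: E ji; rewrite s0 !addn0 !modn_small// => ->; rewrite eqxx.
Qed.

Lemma exists_rotation (n d k t : nat) : exists rho : {perm 'I_n},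
  forall i, (rho @: block n d k i)%SET = block n d k (i + t).
Proof.
have [n00|n0] := posnP n.
  by exists 1%g => i; apply/setP => -[x xn]; exfalso; rewrite n00 in xn.
pose f (x : 'I_n) : 'I_n := Ordinal (ltn_pmod (t * d + x) n0).
have fi : injective f.
  by move=> x y /(congr1 val)/= /eqn_mod_small => E; apply/val_inj/E.
exists (perm fi) => i; apply/setP => x; apply/imsetP/in_block.
  move=> [y /in_block[j jk yE] ->]; exists j => //; rewrite permE/= yE modnDmr.
  by congr (_ %% _)%N; lia.
move=> [j jk xE].
exists (Ordinal (ltn_pmod (i * d + j) n0)); first by apply/in_block; exists j.
apply/val_inj; rewrite permE/= modnDmr xE.
by congr (_ %% _)%N; lia.
Qed.

(** * Counting permutations through their restrictions *)

Definition restr (n : nat) (U : {set 'I_n}) (tau : {perm 'I_n}) : {ffun 'I_n -> option 'I_n} :=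
  [ffun x => if x \in U then Some (tau x) else None].

Lemma restr_eqP (n : nat) (U : {set 'I_n}) (tau tau' : {perm 'I_n}) :
  restr U tau = restr U tau' <-> {in U, tau =1 tau'}.
Proof.
split=> [E x xU|E]; last by apply/ffunP => x; rewrite !ffunE; case: ifP => // /E ->.
by have := congr1 (fun f : {ffun _ -> _} => f x) E; rewrite !ffunE xU => -[].
Qed.

(** Two permutations with the same restriction differ by one that fixes [U] pointwise. *)
Lemma card_le_restr (n : nat) (U : {set 'I_n}) (P : {set {perm 'I_n}}) :
  (#|P| <= #|[set restr U tau | tau in P]%SET| * (n - #|U|)`!)%N.
Proof.
rewrite -sum1_card (partition_big (restr U) (mem [set restr U tau | tau in P]%SET))/=; last first.
  by move=> tau tauP; apply: imset_f.
rewrite -sum_nat_const; apply: leq_sum => f /imsetP[tau0 tau0P fE].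
rewrite sum1_card -[leqRHS](_ : #|perm_on (~: U)%SET| = _); last first.
  by rewrite card_perm cardsCs finset.setCK card_ord.
rewrite -(@card_imset _ _ (fun tau : {perm 'I_n} => (tau * tau0^-1)%g)); last exact: mulIg.
apply: subset_leq_card; apply/fintype.subsetP => _ /imsetP[tau + ->].
rewrite unfold_in => /andP[_ /eqP E].
apply/fintype.subsetP => x; rewrite !inE permM; apply: contraNN => xU.
have /restr_eqP/(_ x xU) -> : restr U tau = restr U tau0 by rewrite E.
by rewrite permK.
Qed.

(* Once tau is known on U and the image of W is fixed, at most |W \ U|^|W \ U|
   extensions to W remain. *)
Lemma card_restr_step (n c : nat) (U W : {set 'I_n}) (P P' : {set {perm 'I_n}}) :
  P' \subset P ->
  (forall tau0, tau0 \in P' -> exists2 J : {set {set 'I_n}}, (#|J| <= c)%N &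
     forall tau, tau \in P' -> {in U, tau =1 tau0} -> (tau @: W)%SET \in J) ->
  (#|[set restr (W :|: U) tau | tau in P']%SET|
     <= c * #|W :\: U| ^ #|W :\: U| * #|[set restr U tau | tau in P]%SET|)%N.
Proof.
move=> /fintype.subsetP PP HJ.
pose cut (g : {ffun 'I_n -> option 'I_n}) : {ffun 'I_n -> option 'I_n} :=
  [ffun x => if x \in U then g x else None].
have cutE tau : cut (restr (W :|: U) tau) = restr U tau.
  by apply/ffunP => x; rewrite !ffunE inE orbC; case: (x \in U).
rewrite -sum1_card (partition_big cut (mem [set restr U tau | tau in P]%SET))/=; last first.
  by move=> _ /imsetP[tau tauP ->]; rewrite cutE; apply: imset_f; apply: PP.
rewrite mulnC -sum_nat_const; apply: leq_sum => f _; rewrite sum1_card.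
have [[g0 g0A]|none] := pickP [pred g in [set restr (W :|: U) tau | tau in P']%SET | cut g == f];
  last by rewrite eq_card0.
move: g0A => /andP[/imsetP[tau0 tau0P ->] /eqP]; rewrite cutE => fE.
have {HJ}[J Jc HJ] := HJ tau0 tau0P.
pose img (g : {ffun 'I_n -> option 'I_n}) := [set y | [exists x in W, g x == Some y]]%SET.
have imgE tau : img (restr (W :|: U) tau) = (tau @: W)%SET.
  apply/setP => y; rewrite inE; apply/exists_inP/imsetP => [[x xW]|[x xW ->]].
    by rewrite ffunE inE xW => /eqP[<-]; exists x.
  by exists x => //; rewrite ffunE inE xW.
rewrite -sum1_card (partition_big img (mem J))/=; last first.
  move=> g; rewrite unfold_in => /andP[/imsetP[tau tauP ->]]; rewrite cutE imgE => /eqP E.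
  by apply: HJ => //; apply/restr_eqP; rewrite E fE.
apply: (@leq_trans (\sum_(Y in J) #|W :\: U| ^ #|W :\: U|)%N); last first.
  by rewrite sum_nat_const leq_mul2r Jc orbT.
apply: leq_sum => Y _; rewrite sum1_card.
(* With the values on [U] and the image [Y] of [W] fixed, [D] must go onto [T], a set of the same
   size. Counting all maps from [D] to [T] is crude but exact when [D] is a single point, as in a
   tight run. *)
set D := (W :\: U)%SET; set T := (Y :\: tau0 @: U)%SET.
have TE tau : restr U tau = f -> (tau @: W)%SET = Y -> (tau @: D)%SET = T.
  rewrite -fE /T => /restr_eqP E <-; apply/setP => y; rewrite inE.
  apply/imsetP/andP => [[x + ->]|[yU /imsetP[x xW yE]]].
    rewrite inE => /andP[xU xW]; split; last exact: imset_f.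
    by apply: contra xU => /imsetP[u uU]; rewrite -(E u uU) => /perm_inj ->.
  exists x => //; rewrite inE xW andbT; apply: contra yU => xU.
  by rewrite yE (E x xU) imset_f.
pose h (g : {ffun 'I_n -> option 'I_n}) : {ffun 'I_n -> option 'I_n} :=
  [ffun x => if x \in D then g x else None].
set F := (X in #|X|); have inF g : g \in F -> exists2 tau, g = restr (W :|: U) tau &
    restr U tau = f /\ (tau @: W)%SET = Y.
  rewrite unfold_in => /andP[+ /eqP gY]; rewrite unfold_in => /andP[/imsetP[tau _ gE] /eqP gf].
  by exists tau => //; rewrite -gY gE imgE; split => //; rewrite -gf gE cutE.
have [g1 g1F|F0] := pickP (mem F); last by rewrite eq_card0.
have [tau1 _ [E1 E2]] := inF g1 g1F.
have cT : #|T| = #|D| by rewrite -(TE _ E1 E2) card_imset//; exact: perm_inj.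
rewrite -[X in (_ <= X ^ _)%N]cT -(card_imset T (@Some_inj _)).
rewrite -(card_pffun_on (None : option 'I_n) (mem D)).
rewrite -(@card_in_imset _ _ h).
  apply: subset_leq_card; apply/fintype.subsetP => _ /imsetP[g /inF[tau gE [Ef EY]] ->].
  apply/(@pffun_onP _ _ None (mem D)); split.
    by apply/supportP => x xD; rewrite ffunE (negPf xD).
  move=> y /fintype.imageP[x xD ->]; rewrite ffunE xD gE ffunE.
  have xW : x \in W by move: xD; rewrite inE => /andP[].
  by rewrite inE xW/=; apply: imset_f; rewrite -(TE _ Ef EY); apply: imset_f.
move=> g g' /inF[tau gE [Ef EY]] /inF[tau' gE' [Ef' EY']] Eh.
apply/ffunP => x.
have [xU|xU] := boolP (x \in U).
  rewrite gE gE' !ffunE !inE xU orbT; congr Some.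
  by move/restr_eqP: (etrans Ef (esym Ef')) => ->.
have [xW|xW] := boolP (x \in W).
  have := congr1 (fun q : {ffun _ -> _} => q x) Eh.
  by rewrite !ffunE inE xU xW.
by rewrite gE gE' !ffunE inE (negPf xU) (negPf xW).
Qed.

(** * Chains of preserved windows *)

Section ChainCounting.
Variables (n d k m : nat).
Hypotheses (d0 : (0 < d)%N) (dk : (d < k)%N) (nE : (n = m * d)%N) (km : (2 * k <= m)%N).

Definition maps_block (tau : {perm 'I_n}) (i : nat) : bool :=
  [exists j : 'I_m, (tau @: block n d k i)%SET == block n d k j].

Definition preserving (s : seq nat) : {set {perm 'I_n}} :=
  [set tau | all (maps_block tau) s]%SET.

Definition covered (s : seq nat) : {set 'I_n} :=
  foldr (fun i U => block n d k i :|: U)%SET finset.set0 s.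

Definition restr_count (s : seq nat) : nat :=
  #|[set restr (covered s) tau | tau in preserving s]%SET|.

(* The block delta steps after the last one contributes [gain delta] uncovered points,
   and [choices delta] bounds the number of its possible images. *)
Definition gain (delta : nat) : nat := minn (delta * d) k.

Definition choices (delta : nat) : nat :=
  if (k <= delta * d)%N then m else if (d == 1)%N && (delta == 1)%N then 1%N else k.

Let n2k : (2 * k <= n)%N.
Proof. by rewrite nE; nia. Qed.

Let block_lt (i : nat) : (i * d + k <= n)%N -> (i < m)%N.
Proof. by rewrite nE; nia. Qed.

Lemma in_covered (s : seq nat) (x : 'I_n) :
  (x \in covered s) = has (fun i => x \in block n d k i) s.
Proof. by elim: s => [|i s IH] /=; rewrite inE// IH. Qed.

(** No block here wraps round and those of [s] end no later than block [h], so the new points form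
    the interval from [a] to the end of the new block. *)
Lemma card_block_setD_covered (h delta : nat) (s : seq nat) :
  all (fun i => i <= h)%N s -> h \in s -> ((h + delta) * d + k <= n)%N ->
  #|block n d k (h + delta) :\: covered s| = gain delta.
Proof.
move=> sh hs hn; set a := maxn (h * d + k) ((h + delta) * d).
have aE : (a + gain delta = (h + delta) * d + k)%N by rewrite /a /gain; nia.
(* An interval starting at [a] is the block of index [a] for [d = 1]. *)
rewrite -[RHS](@card_block n 1 _ a); last lia.
congr #|pred_of_set _|; apply/setP => x.
rewrite inE in_covered (in_block_small x hn) in_block_small ?muln1 ?aE//.
apply/andP/andP => [[/hasPn N /andP[x1 x2]]|[ax x2]].
  have := N h hs; rewrite in_block_small; last by move: hn; rewrite mulnDl; lia.
  by rewrite /a; move: x1 x2; rewrite mulnDl; lia.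
split; last by apply/andP; split=> //; move: ax; rewrite /a geq_max => /andP[].
apply/hasPn => i /(allP sh) ih; rewrite in_block_small; last nia.
by move: ax; rewrite /a geq_max; nia.
Qed.

Lemma restr_count_step (h delta : nat) (s : seq nat) : (0 < delta)%N ->
  all (fun i => i <= h)%N s -> h \in s -> ((h + delta) * d + k <= n)%N ->
  (restr_count ((h + delta)%N :: s)
     <= choices delta * gain delta ^ gain delta * restr_count s)%N.
Proof.
move=> de0 sh hs hn; rewrite /restr_count -(card_block_setD_covered sh hs hn) /=.
set i := (h + delta)%N in hn *.
have im : (i < m)%N by apply: block_lt.
have hlt : (h < m)%N by rewrite (leq_trans _ im)// /i; lia.
have hhn : (h * d + k <= n)%N by move: hn; rewrite /i mulnDl; lia.
apply: card_restr_step.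
  by apply/fintype.subsetP => tau; rewrite !inE /= => /andP[].
move=> tau0; rewrite inE /= => /andP[t0i t0s].
have mapi tau : tau \in preserving (i :: s) -> exists j : 'I_m,
    (tau @: block n d k i)%SET = block n d k j.
  by rewrite inE /= => /andP[/existsP[j /eqP E] _]; exists j.
rewrite /choices; case: ifPn => [far|]; last rewrite -ltnNge => near.
  exists [set block n d k j | j : 'I_m]%SET.
    by rewrite -[leqRHS]card_ord; apply: leq_imset_card.
  by move=> tau /mapi[j ->] _; apply: imset_f.
(* In a tight run [tau] and [tau0] agree on the [k - 1] points [Z0] common to blocks [h] and [i].
   The image of block [i] contains the image of [Z0] and differs from the image of block [h], which
   leaves one candidate. *)
case: ifPn => [/andP[/eqP d1 /eqP de1]|_].
  exists [set (tau0 @: block n d k i)%SET]%SET; first by rewrite cards1.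
  move=> tau tauP E; rewrite inE; apply/eqP.
  have [j tj] := mapi _ tauP.
  have [j' tj'] : exists j : 'I_m, (tau0 @: block n d k i)%SET = block n d k j.
    by apply: mapi; rewrite inE /= t0i.
  have /existsP[a /eqP ta] : maps_block tau0 h by apply: (allP t0s).
  have Eh : {in block n d k h, tau =1 tau0}.
    by move=> x xh; apply: E; rewrite in_covered; apply/hasP; exists h.
  pose Z0 := (block n d k h :&: block n d k i)%SET.
  have hi : block n d k i != block n d k h.
    apply/eqP => /(@block_inj n d k m i h d0 nE ltac:(lia) n2k im hlt).
    by rewrite /i; lia.
  have dn1 : n = (n * 1)%N by rewrite muln1.
  have mn : m = n by rewrite nE d1 muln1.
  rewrite tj tj'; congr (block n d k _); move: tj tj' ta; rewrite d1 => tj tj' ta.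
  have ltmn (b : 'I_m) : (b < n)%N by rewrite -mn.
  apply: (@tight_block_unique n k a j j' (tau0 @: Z0)%SET) => //.
  - by lia.
  - rewrite card_imset; last exact: perm_inj.
    rewrite -[RHS](@card_block n 1 _ h.+1); last lia.
    rewrite /Z0; congr #|pred_of_set _|; apply/setP => x; rewrite inE.
    rewrite !in_block_small ?d1 /i ?de1 ?muln1; move: hn; rewrite /i d1 de1; lia.
  - by rewrite -ta imsetS// /Z0 d1 subsetIl.
  - rewrite -tj -(eq_in_imset (f := tau)).
      by rewrite imsetS// /Z0 d1 subsetIr.
    by move=> x; rewrite inE => /andP[xh _]; exact: Eh.
  - by rewrite -tj' imsetS// /Z0 d1 subsetIr.
  - apply: contra_neq hi => ja; move: tj ta; rewrite ja => <-.
    have -> : (tau0 @: block n 1 k h)%SET = (tau @: block n 1 k h)%SET.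
      by apply: eq_in_imset => x xh; rewrite Eh// d1.
    by rewrite d1 => /imset_inj -> //; exact: perm_inj.
  - apply: contra_neq hi => ja; move: tj' ta; rewrite ja => <-.
    by rewrite d1 => /imset_inj -> //; exact: perm_inj.
(* The first point of block [i] lies in block [h], so its image is known, and at most [k] blocks
   contain that image. *)
have idn : (i * d < n)%N by lia.
pose x0 : 'I_n := Ordinal idn.
have x0i : x0 \in block n d k i by rewrite in_block_small//=; lia.
have x0h : x0 \in covered s.
  rewrite in_covered; apply/hasP; exists h => //.
  by rewrite in_block_small//=; move: near; rewrite /i mulnDl; lia.
exists [set block n d k j | j : 'I_m in [set j : 'I_m | tau0 x0 \in block n d k j]%SET]%SET.
  by apply: leq_trans (leq_imset_card _ _) _; exact: card_blocks_through.
move=> tau /mapi[j tj] E; rewrite tj; apply: imset_f.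
by rewrite inE -(E _ x0h) -tj imset_f.
Qed.

End ChainCounting.

(** The newest index is at the head: a chain is a decreasing list ending in 0. It is built by its
    steps [delta] because the weights multiply along them. *)
Fixpoint chains (M b : nat) : seq (seq nat) :=
  if b is b'.+1 then
    [seq (head 0 s + delta)%N :: s | s <- chains M b', delta <- iota 1 (M.-1 - head 0 s)%N]
  else [:: [:: 0%N]].

Lemma chainsP (M b : nat) (s : seq nat) : (0 < M)%N -> s \in chains M b ->
  [/\ size s = b.+1, all (fun i => i <= head 0 s)%N s, head 0%N s \in s & (head 0 s < M)%N].
Proof.
move=> M0; elim: b s => [|b IH] s /=; first by rewrite inE => /eqP ->.
move=> /allpairsPdep[t [delta [/IH[st ht hint hM]]]].
rewrite mem_iota => /andP[de0 deM] ->; split => /=.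
- by rewrite st.
- rewrite leqnn/=; apply: sub_all ht => i /leq_trans; apply; exact: leq_addr.
- exact: mem_head.
- lia.
Qed.

Section Weights.
Variables (R : realType) (n d k m : nat) (y : R).
Hypotheses (d0 : (0 < d)%N) (dk : (d < k)%N) (nE : (n = m * d)%N) (km : (2 * k <= m)%N).
Hypothesis (y0 : 0 <= y).

Let e_n : R := expR 1 / n%:R.

(** Times [n!], this bounds the total contribution of the permutations preserving [s], the power of
    [e / n] coming from the number of extensions of a partial map. *)
Definition weight (s : seq nat) : R :=
  (restr_count n d k m s)%:R * e_n ^+ #|covered n d k s| * y ^+ size s.

Definition step_weight (delta : nat) : R :=
  (choices d k m delta * gain d k delta ^ gain d k delta)%:R * e_n ^+ gain d k delta * y.

Definition total_step_weight : R := \sum_(delta <- iota 1 (m - k)) step_weight delta.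

Let n0 : (0 < n)%N. Proof. by rewrite nE; nia. Qed.

Let e_n0 : 0 <= e_n. Proof. by rewrite divr_ge0 ?expR_ge0. Qed.

Let block_le (h : nat) : (h < m - k)%N -> (h * d + k <= n)%N.
Proof. by rewrite nE; nia. Qed.

Lemma step_weight_ge0 (delta : nat) : 0 <= step_weight delta.
Proof. by rewrite !mulr_ge0// exprn_ge0. Qed.

Lemma weight_ge0 (s : seq nat) : 0 <= weight s.
Proof. by rewrite !mulr_ge0// exprn_ge0. Qed.

Lemma weight_step (h delta : nat) (s : seq nat) : (0 < delta)%N ->
  all (fun i => i <= h)%N s -> h \in s -> ((h + delta) * d + k <= n)%N ->
  weight ((h + delta)%N :: s) <= step_weight delta * weight s.
Proof.
move=> de0 sh hs hn.
have cov : #|covered n d k ((h + delta)%N :: s)| = (gain d k delta + #|covered n d k s|)%N.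
  rewrite -(card_block_setD_covered d0 dk nE km sh hs hn) cardsD.
  by rewrite addnBAC ?subset_leq_card ?subsetIl//= cardsU.
rewrite /weight cov /= exprD exprS.
have := restr_count_step d0 dk nE km de0 sh hs hn; rewrite -(ler_nat R) natrM.
set A := _%:R => H; set B := restr_count _ _ _ _ s.
have -> : step_weight delta * (B%:R * e_n ^+ #|covered n d k s| * y ^+ size s) =
    (choices d k m delta * gain d k delta ^ gain d k delta)%:R * B%:R *
    (e_n ^+ gain d k delta * e_n ^+ #|covered n d k s| * (y * y ^+ size s)).
  by rewrite /step_weight; ring.
rewrite -mulrA ler_wpM2r//.
by rewrite !mulr_ge0// ?exprn_ge0.
Qed.

(** The first block has [m] possible images and [k] new points, exactly like a block after a long
    gap, and [delta = k] is such a gap. *)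
Lemma weight_start : weight [:: 0%N] <= step_weight k.
Proof.
have cov : #|covered n d k [:: 0%N]| = k.
  by rewrite /= finset.setU0 card_block// nE; nia.
have gk : gain d k k = k by rewrite /gain; nia.
have ck : choices d k m k = m by rewrite /choices ifT//; nia.
rewrite /weight /step_weight cov gk ck expr1 -!mulrA ler_wpM2r//.
  by rewrite mulr_ge0// exprn_ge0.
rewrite ler_nat /restr_count /=.
apply: leq_trans (@card_restr_step n m finset.set0 (block n d k 0) finset.setT _ _ _) _.
- exact: finset.subsetT.
- move=> tau0 _; exists [set block n d k j | j : 'I_m]%SET.
    by rewrite -[leqRHS]card_ord; apply: leq_imset_card.
  by move=> tau; rewrite inE /= andbT => /existsP[j /eqP ->] _; apply: imset_f.
- rewrite finset.setD0 card_block; last by rewrite nE; nia.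
  rewrite -[leqRHS]muln1 leq_mul2l.
  rewrite -[X in (_ <= X)%N](@cards1 _ (restr finset.set0 (1%g : {perm 'I_n}))).
  apply/orP; right; apply: subset_leq_card; apply/fintype.subsetP => _ /imsetP[tau _ ->].
  by rewrite inE; apply/eqP/restr_eqP => x; rewrite inE.
Qed.

Lemma sum_weight_chains (b : nat) :
  \sum_(s <- chains (m - k) b) weight s <= total_step_weight ^+ b * step_weight k.
Proof.
elim: b => [|b IH]; first by rewrite /= big_seq1 expr0 mul1r weight_start.
rewrite exprS -mulrA; apply: (@le_trans _ _
  (total_step_weight * \sum_(s <- chains (m - k) b) weight s)); last first.
  by rewrite ler_wpM2l// sumr_ge0// => delta _; exact: step_weight_ge0.
rewrite /= big_allpairs_dep mulr_sumr !big_seq; apply: ler_sum => s sc.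
have M0 : (0 < m - k)%N by lia.
have [_ sh hs hM] := chainsP M0 sc.
rewrite mulr_suml.
apply: (@le_trans _ _ (\sum_(delta <- iota 1 ((m - k).-1 - head 0%N s))
    step_weight delta * weight s)).
  rewrite !big_seq; apply: ler_sum => delta; rewrite mem_iota => /andP[de0 deM].
  by apply: weight_step => //; apply: block_le; lia.
(* The admissible steps depend on the head of [s]; enlarging them to a fixed range makes the sum
   factor. *)
have -> : iota 1 (m - k) = iota 1 ((m - k).-1 - head 0%N s) ++
    iota (1 + ((m - k).-1 - head 0%N s)) (head 0%N s).+1.
  by rewrite -iotaD; congr iota; lia.
rewrite big_cat/= lerDl sumr_ge0// => delta _.
by rewrite mulr_ge0 ?step_weight_ge0 ?weight_ge0.
Qed.

Definition preserved (tau : {perm 'I_n}) (M : nat) : seq nat :=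
  rev [seq i <- iota 0 M | maps_block d k m tau i].

Lemma preserved_chain (tau : {perm 'I_n}) (M : nat) : (0 < M <= m - k)%N ->
  maps_block d k m tau 0 ->
  preserved tau M \in chains (m - k) (size (preserved tau M)).-1.
Proof.
case: M => // M /= MM t0; elim: M MM => [|M IH] MM.
  by rewrite /preserved /= t0 inE.
have {IH} := IH (ltnW MM).
have E : iota 0 M.+2 = iota 0 M.+1 ++ [:: M.+1] by rewrite -[M.+2]addn1 iotaD.
rewrite /preserved E filter_cat; move: (iota 0 M.+1) (mem_iota 0 M.+1) => I memI /=.
case: ifP => tM; last by rewrite cats0.
rewrite rev_cat /=; set L := rev _ => Lc.
have M0 : (0 < m - k)%N by lia.
have [sL _ hL _] := chainsP M0 Lc.
have hM : (head 0%N L <= M)%N.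
  by move: hL; rewrite mem_rev mem_filter memI => /andP[_]; lia.
have -> : size L = (size L).-1.+1 by rewrite sL.
rewrite /=; apply/allpairsPdep; exists L, (M.+1 - head 0%N L)%N; split => //.
  by rewrite mem_iota; lia.
by congr (_ :: _); lia.
Qed.

Lemma card_preserving_le (s : seq nat) :
  #|preserving n d k m s|%:R * y ^+ size s <= n`!%:R * weight s.
Proof.
have cn : (#|covered n d k s| <= n)%N by rewrite -[leqRHS]card_ord max_card.
rewrite /weight mulrA ler_wpM2r ?exprn_ge0// mulrCA.
apply: (@le_trans _ _ ((restr_count n d k m s)%:R * (n - #|covered n d k s|)`!%:R)).
  by rewrite -natrM ler_nat; apply: card_le_restr.
by rewrite ler_wpM2l// fact_sub_le.
Qed.

(** Each [tau] is charged to the chain of all its preserved indices below [m - k]. Letting a chain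
    collect every permutation that preserves at least its blocks only increases the sum, which then
    becomes geometric in the length of the chain. *)
Lemma sum_preserved_le : total_step_weight < 1 ->
  \sum_(tau : {perm 'I_n} | maps_block d k m tau 0) y ^+ size (preserved tau (m - k))
    <= n`!%:R * (step_weight k / (1 - total_step_weight)).
Proof.
move=> O1; set M := (m - k)%N; have M0 : (0 < M)%N by rewrite /M; lia.
have O0 : 0 <= total_step_weight by rewrite sumr_ge0// => delta _; exact: step_weight_ge0.
apply: (@le_trans _ _ (\sum_(tau : {perm 'I_n}) \sum_(b < M) \sum_(s <- chains M b)
    (tau \in preserving n d k m s)%:R * y ^+ size s)).
  rewrite big_mkcond/=; apply: ler_sum => tau _; case: ifP => [t0|_]; last first.
    by rewrite !sumr_ge0// => b _; rewrite sumr_ge0// => s _; rewrite mulr_ge0// exprn_ge0.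
  set L := preserved tau M.
  have Lc : L \in chains M (size L).-1 by apply: preserved_chain; rewrite ?M0/=.
  have [sL _ _ _] := chainsP M0 Lc.
  have bM : ((size L).-1 < M)%N.
    have : (size L <= M)%N.
      rewrite /L /preserved size_rev size_filter -[leqRHS](size_iota 0 M).
      exact: count_size.
    by move: sL => ->.
  rewrite (bigD1 (Ordinal bM))//= ler_wpDr//.
    by rewrite !sumr_ge0// => b _; rewrite sumr_ge0// => s _; rewrite mulr_ge0// exprn_ge0.
  rewrite (big_rem L)//= ler_wpDr//.
    by rewrite !sumr_ge0// => s _; rewrite mulr_ge0// exprn_ge0.
  rewrite inE [all _ _](_ : _ = true) ?mul1r//.
  by apply/allP => i; rewrite mem_rev mem_filter => /andP[].
rewrite exchange_big/=.
apply: (@le_trans _ _ (\sum_(b < M) n`!%:R * (total_step_weight ^+ b * step_weight k))).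
  apply: ler_sum => b _; rewrite exchange_big/=.
  apply: (@le_trans _ _ (\sum_(s <- chains M b) n`!%:R * weight s)).
    apply: ler_sum => s _; rewrite -mulr_suml -natr_sum.
    by rewrite -big_mkcond/= sum1_card; exact: card_preserving_le.
  by rewrite -mulr_sumr ler_wpM2l// sum_weight_chains.
rewrite -mulr_sumr ler_wpM2l// -mulr_suml mulrC ler_wpM2l ?step_weight_ge0//.
rewrite -[leRHS]mul1r ler_pdivlMr ?subr_gt0//.
have -> : (\sum_(b < M) total_step_weight ^+ b) * (1 - total_step_weight)
    = 1 - total_step_weight ^+ M.
  by rewrite -[RHS]opprB subrX1; ring.
by rewrite gerBl exprn_ge0.
Qed.

End Weights.

(** * Rotating to a gap *)

Lemma count_shift (P : pred nat) (m t : nat) : (forall i, P (i + m)%N = P i) ->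
  count P (iota t m) = count P (iota 0 m).
Proof.
move=> Pm; case: m Pm => // m Pm; elim: t => // t <-.
have -> : iota t.+1 m.+1 = iota t.+1 m ++ [:: (t + m.+1)%N].
  by rewrite -[m.+1 in LHS]addn1 iotaD addSnnS.
by rewrite count_cat /= Pm !addn0 addnC.
Qed.

(* Without a gap, every k consecutive indices contain one satisfying P. *)
Lemma gap_or_dense (P : pred nat) (k m : nat) : (k <= m)%N ->
  (forall i, P (i + m)%N = P i) -> has P (iota 0 m) ->
  (exists2 t, (t < m)%N & P t /\ ~~ has P (iota (t + (m - k)) k)) \/
  (m <= k * count P (iota 0 m))%N.
Proof.
move=> km Pm hP.
have m0 : (0 < m)%N by case: (m) hP.
have Pmod i : P (i %% m)%N = P i.
  rewrite {2}(divn_eq i m); elim: (i %/ m)%N => // q IH.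
  by rewrite mulSn -addnA addnC Pm.
have [[t tm tP]|nogap] := pselect (exists2 t, (t < m)%N &
    P t /\ ~~ has P (iota (t + (m - k)) k)); [by left; exists t | right].
have ex i : exists de, P (i + de)%N.
  have /hasP[t] := hP; rewrite mem_iota /= => tm Pt.
  exists (t + (i * m - i))%N.
  have -> : (i + (t + (i * m - i)) = i * m + t)%N by have := leq_pmulr i m0; lia.
  by rewrite -Pmod modnMDl Pmod.
have win i : (1 <= \sum_(de < k) P (i + de)%N)%N.
  have [de Pde demin] := ex_minnP (ex i).
  have dek : (de < k)%N.
    (* Here [i + de] is the first index from [i] on that satisfies [P]. If [de >= k], the [k]
       indices before it fail [P]; modulo [m] they are those starting at
       [(i + de) %% m + (m - k)]. *)
    rewrite ltnNge; apply/negP => kde; apply: nogap.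
    exists ((i + de) %% m)%N; first by rewrite ltn_mod.
    split; first by rewrite Pmod.
    apply/hasPn => j; rewrite mem_iota => /andP[j1 j2].
    pose u := (j - ((i + de) %% m + (m - k)))%N.
    have uk : (u < k)%N by rewrite /u; lia.
    have jE : (j = (i + de) %% m + (m - k) + u)%N by rewrite /u; lia.
    have -> : P j = P (i + (de - k + u))%N.
      rewrite -Pmod jE -addnA modnDml -[RHS]Pm.
      by rewrite -[RHS]Pmod; congr (P (_ %% _)%N); lia.
    by apply/negP => /demin; lia.
  by rewrite (bigD1 (Ordinal dek))//= Pde.
(* Double counting: each of the [m] stretches of length [k] contains an index satisfying [P], and
   each such index lies in [k] stretches. *)
apply: (@leq_trans (\sum_(i < m) \sum_(de < k) P (i + de)%N)).
  rewrite -[X in (X <= _)%N]card_ord -sum1_card; apply: leq_sum => i _; exact: win.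
rewrite exchange_big/= -[X in (_ <= X * _)%N]card_ord -sum_nat_const; apply: leq_sum => de _.
rewrite -(count_shift de Pm) -[X in iota X]addn0 iotaDl count_map -sum1_count [leqRHS]big_mkcond/=.
have -> : iota 0 m = index_iota 0 m by rewrite /index_iota subn0.
by rewrite big_mkord; apply: leq_sum => i _; rewrite addnC; case: (P _).
Qed.

Section SharedBlocks.
Variables (R : realType) (n d k m : nat) (y a : R).
Hypotheses (d0 : (0 < d)%N) (dk : (d < k)%N) (nE : (n = m * d)%N) (km : (2 * k <= m)%N).
Hypotheses (y1 : 1 <= y) (a1 : 1 <= a).

Definition shared (tau : {perm 'I_n}) : nat := count (maps_block d k m tau) (iota 0 m).

Let maps_block_addm (tau : {perm 'I_n}) (i : nat) :
  maps_block d k m tau (i + m) = maps_block d k m tau i.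
Proof. by rewrite /maps_block (block_addm _ _ nE). Qed.

Let sparse (tau : {perm 'I_n}) : bool :=
  ~~ has (maps_block d k m tau) (iota (m - k) k).

Let dense (tau : {perm 'I_n}) : bool := (m <= k * shared tau)%N.

Let sharedE (tau : {perm 'I_n}) : shared tau =
  (size (preserved d k m tau (m - k)) + count (maps_block d k m tau) (iota (m - k) k))%N.
Proof.
rewrite /shared /preserved size_rev size_filter.
have -> : iota 0 m = iota 0 (m - k) ++ iota (m - k) k.
  by rewrite -[RHS](iotaD 0 (m - k) k); congr iota; lia.
by rewrite count_cat.
Qed.

Let share_weight (tau : {perm 'I_n}) : R :=
  (maps_block d k m tau 0)%:R * ((sparse tau)%:R + (dense tau)%:R) * y ^+ shared tau.

(** Some rotation of each [tau] brings a preserved block to 0 with a gap before it, unless [tau] is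
    dense. Summing over all [m] rotations includes that one, and every rotation merely permutes the
    terms of the sum over [tau]. *)
Let sum_rotations : \sum_(tau : {perm 'I_n}) (0 < shared tau)%N%:R * y ^+ shared tau
  <= m%:R * \sum_(tau : {perm 'I_n}) share_weight tau.
Proof.
have [rho rhoE] : exists rho : nat -> {perm 'I_n}, forall t i,
    (rho t @: block n d k i)%SET = block n d k (i + t).
  by have [rho H] := boolp.choice (exists_rotation n d k); exists rho.
have rot t tau i : maps_block d k m (rho t * tau)%g i = maps_block d k m tau (i + t).
  rewrite /maps_block -rhoE; apply: eq_existsb => j; congr (_ == _).
  rewrite -imset_comp; apply: eq_imset => x; exact: permM.
have rot_count t tau s l : count (maps_block d k m (rho t * tau)%g) (iota s l)
    = count (maps_block d k m tau) (iota (s + t) l).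
  rewrite [(s + t)%N]addnC iotaDl count_map; apply: eq_count => i /=.
  by rewrite rot addnC.
have rot_shared t tau : shared (rho t * tau)%g = shared tau.
  by rewrite /shared rot_count add0n count_shift.
rewrite mulr_natl -[X in _ *+ X]card_ord -sumr_const.
have shift (t : 'I_m) : true -> \sum_(tau : {perm 'I_n}) share_weight tau
    = \sum_(tau : {perm 'I_n}) share_weight (rho t * tau)%g.
  by move=> _; rewrite (reindex_inj (mulgI (rho t))).
rewrite (eq_bigr _ shift) exchange_big/=; apply: ler_sum => tau _.
have W0 t : 0 <= share_weight (rho t * tau)%g.
  by rewrite !mulr_ge0 ?addr_ge0// exprn_ge0// (le_trans ler01).
case: ltnP => [|_]; last by rewrite mul0r sumr_ge0.
rewrite mul1r -has_count => hP.
suff [t tm H] : exists2 t, (t < m)%N & y ^+ shared tau <= share_weight (rho t * tau)%g.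
  by rewrite (bigD1 (Ordinal tm))//= ler_wpDr// sumr_ge0.
have yge : 0 <= y ^+ shared tau by rewrite exprn_ge0// (le_trans ler01).
have [|[t tm [Pt Nt]]|den] := @gap_or_dense (maps_block d k m tau) k m _ (maps_block_addm tau) hP.
- by lia.
- exists t => //; rewrite /share_weight rot_shared rot add0n Pt mul1r.
  rewrite /sparse has_count rot_count [(m - k + t)%N]addnC -has_count Nt ler_peMl//.
  by rewrite lerDl.
- have /hasP[t] := hP; rewrite mem_iota /= => tm Pt.
  exists t => //; rewrite /share_weight rot_shared rot add0n Pt mul1r.
  by rewrite /dense rot_shared den ler_peMl// lerDr.
Qed.

Let share_weight_le (tau : {perm 'I_n}) : share_weight tau <=
  (1 + (y * a ^+ k) ^+ k / a ^+ m) * ((maps_block d k m tau 0)%:R *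
    (y * a ^+ k) ^+ size (preserved d k m tau (m - k))).
Proof.
have y0 : 0 < y by rewrite (lt_le_trans ltr01).
have a0 : 0 < a by rewrite (lt_le_trans ltr01).
have ak1 : 1 <= a ^+ k by rewrite exprn_ege1.
have yak1 : 1 <= y * a ^+ k by rewrite -[1]mulr1 ler_pM.
rewrite /share_weight -mulrA mulrCA [leRHS]mulrCA; case: (maps_block _ _ _ _ _); last first.
  by rewrite !mul0r.
rewrite !mul1r mulrDl mulrDl mul1r; apply: lerD.
  case: (boolP (sparse tau)) => [sp|_]; last first.
    by rewrite mul0r exprn_ge0// (le_trans ler01).
  rewrite mul1r sharedE (_ : count _ _ = 0%N) ?addn0; last first.
    by apply/eqP; rewrite -leqn0 leqNgt -has_count.
  apply: lerXn2r; rewrite ?nnegrE; first exact: ltW.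
    by rewrite mulr_ge0 ?exprn_ge0// ltW.
  by rewrite ler_peMr// ltW.
case: (boolP (dense tau)) => [de|_]; last first.
  by rewrite mul0r !mulr_ge0 ?invr_ge0// exprn_ge0// (le_trans ler01)// ltW.
(* Density gives [a ^+ m <= a ^+ (k * shared tau)]; at most [k] of the shared windows lie in the
   dropped stretch, each worth a factor [y * a ^+ k]. *)
rewrite mul1r mulrAC -exprD ler_pdivlMr ?exprn_gt0//.
apply: (@le_trans _ _ ((y * a ^+ k) ^+ shared tau)).
  rewrite exprMn ler_pM2l ?exprn_gt0// -exprM ler_weXn2l//.
apply: ler_weXn2l => //; rewrite sharedE addnC leq_add2r.
by rewrite -[leqRHS](size_iota (m - k) k) count_size.
Qed.

Lemma sum_shared_le : total_step_weight n d k m (y * a ^+ k) < 1 ->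
  \sum_(tau : {perm 'I_n}) (0 < shared tau)%N%:R * y ^+ shared tau
    <= n`!%:R * (m%:R * (1 + (y * a ^+ k) ^+ k / a ^+ m) *
        (step_weight n d k m (y * a ^+ k) k / (1 - total_step_weight n d k m (y * a ^+ k)))).
Proof.
move=> O1; apply: (le_trans sum_rotations).
have ya0 : 0 <= y * a ^+ k by rewrite mulr_ge0 ?exprn_ge0 ?(le_trans ler01).
have := sum_preserved_le d0 dk nE km ya0 O1; rewrite big_mkcond/= => H.
apply: (@le_trans _ _ (m%:R * ((1 + (y * a ^+ k) ^+ k / a ^+ m) *
   \sum_(tau : {perm 'I_n}) (maps_block d k m tau 0)%:R *
    (y * a ^+ k) ^+ size (preserved d k m tau (m - k))))).
  by rewrite ler_wpM2l// mulr_sumr; apply: ler_sum => tau _; exact: share_weight_le.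
set c := 1 + _; have c0 : 0 <= c.
  by rewrite addr_ge0// divr_ge0 ?exprn_ge0// (le_trans ler01).
have -> : forall F Y : R, F * (m%:R * c * Y) = m%:R * (c * (F * Y)) by move=> F Y; ring.
rewrite ler_wpM2l// ler_wpM2l//.
apply: le_trans H; rewrite le_eqVlt; apply/orP; left; apply/eqP.
by apply: eq_bigr => tau _; case: maps_block; rewrite ?mul1r ?mul0r.
Qed.

End SharedBlocks.

(** * Rainbow Hamilton cycles *)

Lemma prob_mass (R : realType) (n k r : nat) (p : R) (A : pred (colored_hypergraph n k r)) :
  prob p A = \sum_(H : {ffun kset n k -> option 'I_r}) mass (kset_law p) H * (A H)%:R.
Proof.
rewrite /prob big_mkcond/=; apply: eq_bigr => H _.
by case: (A H); rewrite ?mulr1 ?mulr0.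
Qed.

Lemma prob_le1 (R : realType) (n k r : nat) (p : R) (A : pred (colored_hypergraph n k r)) :
  (0 < r)%N -> 0 <= p <= 1 -> prob p A <= 1.
Proof.
move=> r0 p01; rewrite prob_mass -[leRHS](@sum_mass R (kset n k) _ _ (sum_kset_law p r0)).
apply: ler_sum => H _; apply: ler_piMr; last by case: (A H); rewrite /= ?ler01.
by apply: prodr_ge0 => e _; exact: kset_law_ge0.
Qed.

Lemma probC (R : realType) (n k r : nat) (p : R) (A : pred (colored_hypergraph n k r)) :
  (0 < r)%N -> prob p A = 1 - prob p (fun H => ~~ A H).
Proof.
move=> r0; apply/eqP; rewrite eq_sym subr_eq.
rewrite -[eqbLHS](@sum_mass R (kset n k) _ _ (sum_kset_law p r0)).
rewrite !prob_mass -big_split/=; apply/eqP/eq_bigr => H _.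
by case: (A H); rewrite ?mulr1 ?mulr0 ?addr0 ?add0r.
Qed.

Section HamiltonCycles.
Variables (n k l : nat).
Let d := (k - l)%N.
Let m := (n %/ d)%N.
Hypotheses (l0 : (0 < l)%N) (lk : (l < k)%N) (dn : (d %| n)%N) (km : (2 * k <= m)%N).

Let d0 : (0 < d)%N. Proof. by rewrite /d; lia. Qed.
Let k0 : (0 < k)%N. Proof. by lia. Qed.
Let dk : (d < k)%N. Proof. by rewrite /d; lia. Qed.
Let nE : n = (m * d)%N. Proof. by rewrite /m divnK. Qed.
Let n2k : (2 * k <= n)%N. Proof. by rewrite nE; nia. Qed.

Definition cycle_of (pi : {perm 'I_n}) : {set kset n k} :=
  [set e | [exists i : 'I_m, val e == window k l pi i]]%SET.

Let val_cycle_of (pi : {perm 'I_n}) :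
  [set val e | e in cycle_of pi]%SET = [set window k l pi i | i : 'I_m]%SET.
Proof.
apply/setP => A; apply/imsetP/imsetP => [[e + ->]|[i _ ->]].
  by rewrite inE => /existsP[i /eqP ->]; exists i.
have c : #|window k l pi i| == k.
  rewrite windowE card_imset; last exact: perm_inj.
  by rewrite card_block//; lia.
exists (Sub (window k l pi i) c) => //; rewrite inE; apply/existsP.
by exists i; rewrite SubK.
Qed.

Let card_cycle_of (pi : {perm 'I_n}) : #|cycle_of pi| = m.
Proof.
rewrite -(card_imset _ val_inj) val_cycle_of card_imset ?card_ord// => i j.
rewrite !windowE => /(imset_inj (@perm_inj _ pi)) E; apply/val_inj.
exact: (@block_inj n d k m i j d0 nE k0 n2k (ltn_ord i) (ltn_ord j) E).
Qed.

Let rainbow_hamiltonianE (r : nat) (H : colored_hypergraph n k r) :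
  rainbow_hamiltonian l H = [exists pi, rainbow_in (cycle_of pi) H].
Proof.
apply/existsP/existsP => [[C /and3P[/andP[_ /existsP[pi /eqP Cpi]] CH rC]]|[pi]].
  exists pi; have -> : cycle_of pi = C.
    by apply: (imset_inj val_inj); rewrite val_cycle_of Cpi.
  by rewrite rainbow_inE CH.
rewrite rainbow_inE => /andP[CH rC]; exists (cycle_of pi).
rewrite CH rC !andbT; apply/andP; split; first by rewrite card_cycle_of.
by apply/existsP; exists pi; rewrite val_cycle_of.
Qed.

(** Products act from left to right: a window of [pi] is a window of [pi'] exactly when applying
    [pi] and then the inverse of [pi'] takes its block to a block. *)
Let card_common (pi pi' : {perm 'I_n}) :
  #|cycle_of pi :&: cycle_of pi'| = shared d k m (pi * pi'^-1)%g.
Proof.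
rewrite -(card_imset _ val_inj).
have -> : (val @: (cycle_of pi :&: cycle_of pi'))%SET =
    [set window k l pi i | i : 'I_m in [set i : 'I_m | maps_block d k m (pi * pi'^-1)%g i]%SET]%SET.
  have mapsE (i : 'I_m) : maps_block d k m (pi * pi'^-1)%g i =
      [exists j : 'I_m, window k l pi i == window k l pi' j].
    apply: eq_existsb => j; rewrite !windowE -/d; apply/eqP/eqP => [<-|E].
      by rewrite -imset_comp; apply: eq_imset => x /=; rewrite permM permKV.
    have -> : ((pi * pi'^-1)%g @: block n d k i)%SET = (pi'^-1%g @: (pi @: block n d k i))%SET.
      by rewrite -imset_comp; apply: eq_imset => x /=; rewrite permM.
    rewrite E -imset_comp -[RHS]imset_id; apply: eq_imset => x /=; by rewrite permK.
  apply/setP => A; apply/imsetP/imsetP => [[e + ->]|[i + ->]].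
    rewrite !inE => /andP[/existsP[i /eqP ei] /existsP[j /eqP ej]].
    by exists i => //; rewrite inE mapsE; apply/existsP; exists j; rewrite -ei ej.
  rewrite inE mapsE => /existsP[j /eqP ij].
  have := val_cycle_of pi => /setP/(_ (window k l pi i)).
  rewrite [RHS]imset_f// => /imsetP[e epi eE].
  exists e => //; rewrite inE epi inE; apply/existsP.
  by exists j; rewrite -ij eE.
rewrite card_imset; last first.
  move=> i j; rewrite !windowE => /(imset_inj (@perm_inj _ pi)) E; apply/val_inj.
  exact: (@block_inj n d k m i j d0 nE k0 n2k (ltn_ord i) (ltn_ord j) E).
rewrite /shared -sum1_count -sum1_card.
have -> : iota 0 m = index_iota 0 m by rewrite /index_iota subn0.
by rewrite big_mkord; apply: eq_bigl => i; rewrite inE.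
Qed.

Lemma prob_rainbow_hamiltonian_le (R : realType) (r : nat) (p : R) :
  (0 < r)%N -> 0 <= p <= 1 ->
  prob p (fun H : colored_hypergraph n k r => rainbow_hamiltonian l H)
    <= n`!%:R * rainbow_prob r p m.
Proof.
move=> r0 p01; rewrite prob_mass -[n`!]card_Sn.
under eq_bigr do rewrite rainbow_hamiltonianE.
exact: (first_moment r0 p01 card_cycle_of).
Qed.

Lemma prob_not_rainbow_hamiltonian_le (R : realType) (r : nat) (p y a : R) :
  (m <= r)%N -> 0 < p <= 1 -> 1 <= y -> 1 <= a ->
  (forall b, (b <= m)%N -> 1 <= y ^+ b * rainbow_prob r p b) ->
  total_step_weight n d k m (y * a ^+ k) < 1 ->
  prob p (fun H : colored_hypergraph n k r => ~~ rainbow_hamiltonian l H)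
    <= m%:R * (1 + (y * a ^+ k) ^+ k / a ^+ m) *
        (step_weight n d k m (y * a ^+ k) k / (1 - total_step_weight n d k m (y * a ^+ k))).
Proof.
move=> mr p01 y1 a1 yb O1; rewrite prob_mass.
have r0 : (0 < r)%N by lia.
under eq_bigr do rewrite rainbow_hamiltonianE.
have cS : #|{perm 'I_n}| = n`! by exact: card_Sn.
have S0 : (0 < #|{perm 'I_n}|)%N by rewrite cS fact_gt0.
have p0 : 0 < p by case/andP: p01.
apply: (le_trans (second_moment r0 p01 mr S0 card_cycle_of)).
rewrite cS ler_pdivrMr ?exprn_gt0 ?ltr0n ?fact_gt0//.
have := sum_shared_le d0 dk nE km y1 a1 O1; set B := (X in n`!%:R * X) => H.
rewrite -/B.
apply: (@le_trans _ _ (\sum_(pi' : {perm 'I_n}) n`!%:R * B)); last first.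
  have E (F Y : R) : F * (F * Y) = Y * F ^+ 2 by ring.
  by rewrite sumr_const cS -[leLHS]mulr_natl E.
rewrite exchange_big/=; apply: ler_sum => pi' _.
apply: le_trans H.
(* For fixed [pi'] the quotient runs over all permutations, so the sum over pairs is [n!] times a
   sum over one permutation. *)
rewrite [leRHS](reindex_inj (mulIg (pi'^-1)%g))/=; apply: ler_sum => pi _.
rewrite card_common -cards_eq0 card_common lt0n; set s := shared _ _ _ _.
case: eqP => [_|_] /=; first by rewrite !mul0r.
have sm : (s <= m)%N by rewrite /s /shared -[leqRHS](size_iota 0 m) count_size.
by rewrite !mul1r -[leLHS]mul1r ler_pdivrMr ?rainbow_prob_gt0 ?yb// (leq_trans sm).
Qed.

End HamiltonCycles.

(** * Size of the steps *)

Section StepWeightBounds.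
Variables (R : realType) (n d k m : nat) (y : R).
Hypotheses (d0 : (0 < d)%N) (dk : (d < k)%N) (en : expR 1 <= n%:R :> R) (y0 : 0 <= y).

Let e_n : R := expR 1 / n%:R.
Let z : R := e_n ^+ d * y.

(* Bounds [choices] times [gain ^ gain] for a step to the next block; it must be exactly 1
   in the tight case for the constant in (iv) to be sharp. *)
Definition run_factor (d k : nat) : nat := if d == 1%N then 1%N else (k ^ k.+1)%N.

Lemma step_weight_k : step_weight n d k m y k = (m * k ^ k)%:R * e_n ^+ (k - d) * z.
Proof.
have gk : gain d k k = k by rewrite /gain; nia.
have ck : choices d k m k = m by rewrite /choices ifT//; nia.
by rewrite /step_weight gk ck -/e_n -!mulrA; congr (_ * _); rewrite mulrA -exprD subnK// ltnW.
Qed.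

Lemma total_step_weight_le : total_step_weight n d k m y <=
  z * ((run_factor d k)%:R + (k ^ k.+2)%:R * e_n + (m ^ 2 * k ^ k)%:R * e_n ^+ (k - d)).
Proof.
have e0 : 0 <= e_n by rewrite divr_ge0 ?expR_ge0.
have e1 : e_n <= 1.
  by rewrite ler_pdivrMr ?mul1r// (lt_le_trans _ en)// expR_gt0.
have z0 : 0 <= z by rewrite mulr_ge0 ?exprn_ge0.
(* [c1], [c2] and [c3] bound a step to the next block, a short gap and a long gap. *)
pose c1 : R := z * (run_factor d k)%:R.
pose c2 : R := z * ((k ^ k.+1)%:R * e_n).
pose c3 : R := z * ((m * k ^ k)%:R * e_n ^+ (k - d)).
have c10 : 0 <= c1 by rewrite mulr_ge0.
have c20 : 0 <= c2 by rewrite mulr_ge0// mulr_ge0.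
have c30 : 0 <= c3 by rewrite mulr_ge0// mulr_ge0// exprn_ge0.
have bound delta : (0 < delta)%N -> step_weight n d k m y delta <=
    (delta == 1)%N%:R * c1 + (delta < k)%N%:R * c2 + c3.
  move=> de0; rewrite /step_weight -/e_n.
  have [far|near] := leqP k (delta * d).
    apply: (@le_trans _ _ c3); last by rewrite ler_wpDl// addr_ge0// mulr_ge0.
    rewrite /choices far /gain (minn_idPr far).
    have -> : e_n ^+ k = e_n ^+ (k - d) * e_n ^+ d by rewrite -exprD subnK// ltnW.
    by rewrite [leLHS](_ : _ = c3)// /c3 /z; ring.
  have gE : gain d k delta = (delta * d)%N by rewrite /gain; apply/minn_idPl/ltnW.
  rewrite gE.
  have pw : ((delta * d) ^ (delta * d) <= k ^ k)%N.
    apply: (@leq_trans (k ^ (delta * d))).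
      by rewrite leq_exp2r ?muln_gt0 ?de0 ?d0//; exact: ltnW.
    by apply: leq_pexp2l; [lia | exact: ltnW].
  have ck : (choices d k m delta * (delta * d) ^ (delta * d) <= k ^ k.+1)%N.
    rewrite expnS; apply: leq_mul => //; rewrite /choices (leqNgt k) near/=.
    by case: ifP => // _; lia.
  have [de1|de1] := eqVneq delta 1%N.
    apply: (@le_trans _ _ c1); last first.
      by rewrite mul1r -addrA ler_wpDr// addr_ge0// mulr_ge0.
    rewrite /c1 de1 mul1n -mulrA mulrC ler_wpM2l// ler_nat /run_factor.
    case: eqP => [d1|_]; last by move: ck; rewrite de1 mul1n.
    by rewrite /choices d1 eqxx !muln1 ifF//; apply/negbTE; rewrite -ltnNge -d1.
  apply: (@le_trans _ _ c2); last first.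
    rewrite mul0r add0r (_ : (delta < k)%N = true) ?mul1r ?ler_wpDr//.
    by apply: leq_ltn_trans near; rewrite leq_pmulr.
  (* As [delta >= 2], at least [d + 1] points are new, one more than in a run: hence the additional
     factor [e_n]. *)
  have -> : c2 = (k ^ k.+1)%:R * e_n ^+ d.+1 * y by rewrite /c2 /z exprS; ring.
  rewrite ler_wpM2r// ler_pM ?exprn_ge0// ?ler_nat//.
  by rewrite ler_wiXn2l//; nia.
apply: (@le_trans _ _ (\sum_(delta <- iota 1 (m - k))
    ((delta == 1)%N%:R * c1 + (delta < k)%N%:R * c2 + c3))).
  rewrite /total_step_weight !big_seq; apply: ler_sum => delta.
  by rewrite mem_iota => /andP[de0 _]; exact: bound.
apply: (@le_trans _ _ (c1 + k%:R * c2 + m%:R * c3)).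
  move: c1 c2 c3 c10 c20 c30 {bound} => c1 c2 c3 c10 c20 c30.
  rewrite !big_split/= -!mulr_suml -!natr_sum.
  have s1 : (\sum_(delta <- iota 1 (m - k)) (delta == 1) <= 1)%N.
    rewrite -big_mkcond/= sum1_count count_uniq_mem ?iota_uniq//; exact: leq_b1.
  have s2 : (\sum_(delta <- iota 1 (m - k)) (delta < k) <= k)%N.
    rewrite -big_mkcond/= sum1_count -size_filter -[leqRHS](size_iota 0 k).
    apply: uniq_leq_size; first by rewrite filter_uniq ?iota_uniq.
    by move=> x; rewrite mem_filter => /andP[xk _]; rewrite mem_iota.
  rewrite big_const_seq count_predT size_iota iter_addr_0.
  apply: lerD; first apply: lerD.
  - by rewrite -[leRHS]mul1r ler_wpM2r// lern1.
  - by rewrite ler_wpM2r// ler_nat.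
  - by rewrite -[c3 *+ _]mulr_natl ler_wpM2r// ler_nat leq_subr.
rewrite /c1 /c2 /c3 [(k ^ k.+2)%N]expnS -mulnn !natrM le_eqVlt; apply/orP; left; apply/eqP.
ring.
Qed.

End StepWeightBounds.

(** * Asymptotics *)

#[local] Instance multiples_oo_filter (d : nat) : Filter (multiples_oo d).
Proof. exact: within_filter. Qed.

Lemma near_multiples_ge (d N : nat) : \forall n \near multiples_oo d, (N <= n)%N.
Proof. by apply: (@cvg_within nat \oo _ [set n : nat | (d %| n)%N]); exact: nbhs_infty_ge. Qed.

Lemma near_multiples_ger (R : realType) (d : nat) (x : R) :
  \forall n \near multiples_oo d, x <= n%:R.
Proof. by apply: (@cvg_within nat \oo _ [set n : nat | (d %| n)%N]); exact: nbhs_infty_ger. Qed.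

Lemma near_multiples_div_ge (d N : nat) : (0 < d)%N ->
  \forall n \near multiples_oo d, (N <= n %/ d)%N.
Proof.
move=> d0; near=> n; rewrite leq_divRL//; near: n; exact: near_multiples_ge.
Unshelve. all: by end_near. Qed.

Lemma near_multiples_div_ger (R : realType) (d : nat) (x : R) : (0 < d)%N ->
  \forall n \near multiples_oo d, x <= (n %/ d)%:R.
Proof.
move=> d0; near=> n; apply: (@le_trans _ _ (Num.bound `|x|)%:R).
  by apply: le_trans (ler_norm _) _; apply/ltW/archi_boundP.
rewrite ler_nat; near: n; exact: near_multiples_div_ge.
Unshelve. all: by end_near. Qed.

Lemma near_multiples_inv_le (R : realType) (d : nat) (c e : R) : 0 < e ->
  \forall n \near multiples_oo d, c / n%:R <= e.
Proof.
move=> e0; near=> n.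
have n0 : 0 < n%:R :> R.
  by rewrite (@lt_le_trans _ _ 1)//; near: n; exact: near_multiples_ger.
rewrite ler_pdivrMr// mulrC -ler_pdivrMr//; near: n; exact: near_multiples_ger.
Unshelve. all: by end_near. Qed.

Lemma near_multiples_dvd (d : nat) : \forall n \near multiples_oo d, (d %| n)%N.
Proof. exact: near_withinT. Qed.

Lemma whp_of_prob_not_le (R : realType) (d k : nat) (r : nat -> nat) (p : nat -> R)
    (A : forall n, pred (colored_hypergraph n k (r n))) :
  (\forall n \near multiples_oo d, (0 < r n)%N /\ 0 <= p n <= 1) ->
  (forall e : R, 0 < e -> \forall n \near multiples_oo d,
      prob (p n) (fun H => ~~ A n H) <= e) ->
  whp d p A.
Proof.
move=> Hrp HA; apply/cvgrPdist_le => e e0.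
near=> n.
have [rn pn] : (0 < r n)%N /\ 0 <= p n <= 1 by near: n.
rewrite ger0_norm ?subr_ge0 ?prob_le1//.
rewrite probC// opprB addrC subrK; near: n; exact: HA.
Unshelve. all: by end_near. Qed.

Section SecondMomentWhp.
Variables (R : realType) (k l d : nat) (r : nat -> nat) (p y : nat -> R) (rho : R).
Hypotheses (l2 : (2 <= l)%N) (lk : (l < k)%N) (dE : d = (k - l)%N) (rho1 : 0 < rho < 1).
Hypothesis r_ge : \forall n \near multiples_oo d, (n %/ d <= r n)%N.
Hypothesis p01 : \forall n \near multiples_oo d, 0 < p n <= 1.
Hypothesis y1 : \forall n \near multiples_oo d, 1 <= y n.
Hypothesis yQ : \forall n \near multiples_oo d, forall b, (b <= n %/ d)%N ->
  1 <= y n ^+ b * rainbow_prob (r n) (p n) b.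
Hypothesis yrho : \forall n \near multiples_oo d,
  (expR 1 / n%:R) ^+ d * y n * (run_factor d k)%:R <= rho.
Hypothesis y_small : forall e : R, 0 < e -> \forall n \near multiples_oo d,
  ((n %/ d) ^ 2)%:R * (expR 1 / n%:R) ^+ l * ((expR 1 / n%:R) ^+ d * y n) <= e.

(** [yrho] keeps the ratio of the geometric series below 1, and [y_small] makes both the long gaps
    and the first term of the series negligible. *)
Lemma second_moment_whp : whp d p (fun n (H : colored_hypergraph n k (r n)) =>
  rainbow_hamiltonian l H).
Proof.
have d0 : (0 < d)%N by lia.
have dk : (d < k)%N by lia.
have k0 : (0 < k)%N by lia.
have l0 : (0 < l)%N by lia.
have kdl : (k - d = l)%N by lia.
have [rho0 rho_lt1] := andP rho1.
(* Chosen so that [a ^+ k = rho^(-1/2)]; the inflated run cost [s = a ^+ k * rho] is then the square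
   root of [rho], still below 1. *)
pose t : R := - ln rho / (2 * k%:R).
have t0 : 0 < t.
  by rewrite divr_gt0 ?mulr_gt0 ?ltr0n// oppr_gt0 ln_lt0// rho0.
pose a : R := expR t.
have a1 : 1 < a by rewrite expR_gt1.
have a0 : 0 < a by rewrite expR_gt0.
pose A : R := a ^+ k.
have A0 : 0 < A by rewrite exprn_gt0.
pose s : R := A * rho.
have s1 : s < 1.
  rewrite /s -[X in _ * X](lnK (x := rho)) ?posrE// /A /a -expRM_natl -expRD expR_lt1.
  have -> : k%:R * t = - ln rho / 2.
    by rewrite /t; field; rewrite pnatr_eq0 -lt0n k0.
  have : ln rho < 0 by rewrite ln_lt0// rho0.
  lra.
have s0 : 0 < s by rewrite mulr_gt0.
have [C C0 HC] := @exprn_poly_bound R a (d * k) a1.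
(* Bounds the seam factor [1 + y' ^+ k / a ^+ m]: [z <= 1] gives [y' <= n ^ d], and a power of [m]
   with exponent [d * k] is at most [C * a ^+ m]. *)
pose B : R := 1 + d%:R ^+ (d * k) * C * A ^+ k.
have B0 : 0 < B by rewrite ltr_pwDl// !mulr_ge0 ?exprn_ge0// ltW.
apply: whp_of_prob_not_le.
  near=> n.
  have /andP[pn0 pn1] : 0 < p n <= 1 by near: n.
  split; last by rewrite ltW.
  apply: leq_trans (_ : (n %/ d <= _)%N); last by near: n.
  near: n; exact: near_multiples_div_ge.
move=> e e0.
(* The second term limits long gaps to [(1 - s) / 4]; short gaps take as much, so the ratio stays
   [(1 - s) / 2] below 1. The first term then brings the final bound down to [e]. *)
pose e1 := Num.min (e * ((1 - s) / 2) / (B * (k ^ k)%:R * A)) ((1 - s) / 4 / ((k ^ k)%:R * A)).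
have kk0 : 0 < (k ^ k)%:R :> R by rewrite ltr0n expn_gt0 k0.
have e10 : 0 < e1.
  by rewrite lt_min !divr_gt0 ?mulr_gt0 ?divr_gt0 ?subr_gt0.
near=> n.
have dn : (d %| n)%N by near: n; exact: near_multiples_dvd.
have km : (2 * k <= n %/ d)%N by near: n; exact: near_multiples_div_ge.
have mr : (n %/ d <= r n)%N by near: n.
have p01n : 0 < p n <= 1 by near: n.
have y1n : 1 <= y n by near: n.
have yQn : forall b, (b <= n %/ d)%N -> 1 <= y n ^+ b * rainbow_prob (r n) (p n) b by near: n.
have yrhon : (expR 1 / n%:R) ^+ d * y n * (run_factor d k)%:R <= rho by near: n.
have ysn : ((n %/ d) ^ 2)%:R * (expR 1 / n%:R) ^+ l * ((expR 1 / n%:R) ^+ d * y n) <= e1.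
  by near: n; exact: y_small.
have en : expR 1 <= n%:R :> R by near: n; exact: near_multiples_ger.
have Ek : (k ^ k.+2)%:R * (expR 1 / n%:R) <= (1 - s) / 4.
  rewrite mulrA; near: n; apply: near_multiples_inv_le.
  by rewrite divr_gt0// subr_gt0.
set m := (n %/ d)%N in km mr yQn ysn *; set E : R := expR 1 / n%:R in yrhon ysn Ek *.
have nE : n = (m * d)%N by rewrite /m divnK.
have m0 : (0 < m)%N by apply: leq_trans km; rewrite muln_gt0 k0.
have n_gt0 : (0 < n)%N by rewrite nE muln_gt0 m0 d0.
have E0 : 0 < E by rewrite divr_gt0 ?expR_gt0 ?ltr0n.
have y0n : 0 < y n by rewrite (lt_le_trans ltr01).
pose y' := y n * A.
have y'0 : 0 <= y' by rewrite mulr_ge0// ltW.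
pose z := E ^+ d * y'.
have z0 : 0 <= z by rewrite mulr_ge0// exprn_ge0// ltW.
have zs : z * (run_factor d k)%:R <= s.
  have -> : z * (run_factor d k)%:R = A * (E ^+ d * y n * (run_factor d k)%:R).
    by rewrite /z /y'; ring.
  by rewrite ler_wpM2l// ltW.
have rf1 : 1 <= (run_factor d k)%:R :> R.
  by rewrite ler1n /run_factor; case: eqP => // _; rewrite expn_gt0 k0.
have zs1 : z <= s by apply: le_trans zs; rewrite ler_peMr.
have S1 : z * ((m ^ 2 * k ^ k)%:R * E ^+ l) <= e1 * (k ^ k)%:R * A.
  have -> : z * ((m ^ 2 * k ^ k)%:R * E ^+ l) =
      (m ^ 2)%:R * E ^+ l * (E ^+ d * y n) * ((k ^ k)%:R * A).
    by rewrite /z /y' natrM; ring.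
  by rewrite -[leRHS]mulrA ler_wpM2r// mulr_ge0// ltW.
have Om : total_step_weight n d k m y' <= s + (1 - s) / 2.
  apply: (le_trans (@total_step_weight_le R n d k m y' d0 dk en y'0)).
  rewrite -/E -/z kdl !mulrDr.
  have H2 : z * ((k ^ k.+2)%:R * E) <= (1 - s) / 4.
    apply: le_trans Ek; rewrite ler_piMl//; last by rewrite (le_trans zs1)// ltW.
    by rewrite mulr_ge0// ltW.
  have H3 : z * ((m ^ 2 * k ^ k)%:R * E ^+ l) <= (1 - s) / 4.
    apply: (le_trans S1); rewrite -mulrA -ler_pdivlMr ?mulr_gt0//.
    by rewrite ge_min lexx orbT.
  lra.
have Om1 : total_step_weight n d k m y' < 1 by apply: (le_lt_trans Om); lra.
move: (@prob_not_rainbow_hamiltonian_le n k l l0 lk).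
rewrite -dE => /(_ dn km R (r n) (p n) (y n) a mr p01n y1n (ltW a1) yQn Om1).
move/le_trans; apply.
rewrite -/m -/A -/y' (@step_weight_k R n d k m y' d0 dk en y'0) -/E -/z kdl.
have y'n : y' <= n%:R ^+ d.
  have : z <= 1 by rewrite (le_trans zs1)// ltW.
  rewrite /z /E expr_div_n mulrAC ler_pdivrMr ?exprn_gt0 ?ltr0n// mul1r.
  apply: le_trans; rewrite ler_peMl// exprn_ege1//.
  by rewrite -expR0 ler_expR.
have HB : 1 + y' ^+ k / a ^+ m <= B.
  rewrite lerD2l ler_pdivrMr ?exprn_gt0//.
  apply: (@le_trans _ _ ((n%:R ^+ d) ^+ k)).
    by apply: lerXn2r; rewrite ?nnegrE// exprn_ge0.
  rewrite -exprM nE natrM exprMn.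
  apply: (@le_trans _ _ (C * a ^+ m * d%:R ^+ (d * k))).
    by rewrite ler_wpM2r ?exprn_ge0.
  have -> : d%:R ^+ (d * k) * C * A ^+ k * a ^+ m = C * a ^+ m * d%:R ^+ (d * k) * A ^+ k.
    by ring.
  by rewrite ler_peMr ?mulr_ge0 ?exprn_ge0 ?exprn_ege1//; rewrite ?ltW// exprn_ege1// ltW.
(* The [m] rotations and the [m] images of the first block combine into the [m ^ 2] of [y_small]. *)
have -> : m%:R * (1 + y' ^+ k / a ^+ m) * ((m * k ^ k)%:R * E ^+ l * z /
     (1 - total_step_weight n d k m y'))
   = (1 + y' ^+ k / a ^+ m) * (z * ((m ^ 2 * k ^ k)%:R * E ^+ l)) /
     (1 - total_step_weight n d k m y').
  by rewrite -mulnn !natrM; ring.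
rewrite ler_pdivrMr ?subr_gt0//.
apply: (@le_trans _ _ (e * ((1 - s) / 2))); last by rewrite ler_wpM2l ?(ltW e0)//; lra.
apply: (@le_trans _ _ (B * (e1 * (k ^ k)%:R * A))).
  apply: ler_pM => //.
  - by rewrite addr_ge0// divr_ge0// exprn_ge0// ltW.
  - by rewrite mulr_ge0// mulr_ge0// exprn_ge0// ltW.
have -> : B * (e1 * (k ^ k)%:R * A) = e1 * (B * (k ^ k)%:R * A) by ring.
by rewrite -ler_pdivlMr ?mulr_gt0// ge_min lexx.
Unshelve. all: by end_near. Qed.

End SecondMomentWhp.

(** * Rounding, falling factorials and the thresholds *)

Lemma rounding_bounds (R : realType) (x : R) (r : nat) : rounding x r ->
  [/\ r%:R - x <= 1, x - r%:R <= 1, forall m : nat, m%:R <= x -> (m <= r)%N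
    & forall m : nat, x <= m%:R -> (r <= m)%N].
Proof.
have rE : r%:R = (r%:Z)%:~R :> R by rewrite pmulrn.
case=> Hr; split.
- have := floor_le x; rewrite -Hr -rE; lra.
- have /andP[_] := floor_itv x; rewrite -Hr intrD -rE; lra.
- by move=> m mx; rewrite -lez_nat Hr floor_ge_int -pmulrn.
- by move=> m xm; rewrite -(ler_nat R) rE Hr (le_trans (floor_le x)).
- have := ceilB1_lt x; rewrite -Hr intrB -rE; lra.
- have := ceil_ge x; rewrite -Hr -rE; lra.
- by move=> m mx; rewrite -(ler_nat R) rE Hr (le_trans _ (ceil_ge x)).
- by move=> m xm; rewrite -lez_nat Hr ceil_le_int -pmulrn.
Qed.

Lemma admissible_ge (R : realType) (d : nat) (c : R) (r : nat -> nat) (p : nat -> R) (n : nat) :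
  (0 < d)%N -> admissible d c r p -> (d %| n)%N -> (n %/ d <= r n)%N.
Proof.
move=> d0 [cd rr _] dn; have [_ _ + _] := rounding_bounds (rr n dn); apply.
rewrite -{2}(divnK dn) natrM mulrCA -[leLHS]mulr1 ler_wpM2l//.
by move: cd; rewrite ler_pdivrMr ?ltr0n.
Qed.

Lemma scaled_rainbow_prob_ge1 (R : realType) (r b : nat) (p g : R) :
  (0 < r)%N -> 0 < p -> r%:R ^+ b <= g ^+ b * (r ^_ b)%:R ->
  1 <= (g / p) ^+ b * rainbow_prob r p b.
Proof.
move=> r0 p0 H; rewrite rainbow_probE mulrA -exprMn.
have -> : g / p * (p / r%:R) = g / r%:R.
  have rr0 : 0 < r%:R :> R by rewrite ltr0n.
  by field; rewrite ?gt_eqF//=.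
by rewrite expr_div_n mulrAC ler_pdivlMr ?exprn_gt0 ?ltr0n// mul1r.
Qed.

Lemma scaled_weight (R : realType) (n d : nat) (p g : R) :
  (expR 1 / n%:R) ^+ d * (g / p) = g * expR 1 ^+ d / (n%:R ^+ d * p).
Proof. by rewrite expr_div_n invfM; ring. Qed.

(** [r ^_ m] is [r! / (r - m)!], bounded by the two halves of Stirling's estimate. For [r = m] the
    quotient by zero is raised to the power 0 and counts as 1. *)
Lemma ffact_expR_le (R : realType) (r m : nat) : (0 < r)%N -> (m <= r)%N ->
  (r ^_ m)%:R * expR 1 ^+ m
    <= expR 1 * r%:R * (r%:R / (r - m)%:R) ^+ (r - m) * r%:R ^+ m :> R.
Proof.
move=> r0 mr; set N := (r - m)%N; set e : R := expR 1.
have NN0 : 0 < N%:R ^+ N :> R.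
  by case: (N) => [|N']; rewrite ?expr0// exprn_gt0.
rewrite expr_div_n mulrA [leRHS]mulrAC ler_pdivlMr//.
have rE : r = (N + m)%N by rewrite subnK.
have e0 : 0 < e by exact: expR_gt0.
apply: (@le_trans _ _ (r`!%:R * e ^+ r)).
  rewrite -(ffact_fact mr) natrM -/N [in e ^+ r]rE exprD.
  have := fact_ge_exp R N; rewrite -/e => H.
  have -> : (r ^_ m)%:R * N`!%:R * (e ^+ N * e ^+ m) =
      (r ^_ m)%:R * e ^+ m * (e ^+ N * N`!%:R) by ring.
  by rewrite ler_wpM2l// mulr_ge0// exprn_ge0// ltW.
have := fact_le_exp R r0; rewrite -/e => /le_trans; apply.
by rewrite -!mulrA -exprD -rE.
Qed.

Lemma expr_le_ffact_of (R : realType) (r n : nat) (g : R) : (0 < r - n)%N -> (n <= r)%N ->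
  0 <= g ->
  expR 1 * (r - n)%:R * ((r - n)%:R / r%:R) ^+ (r - n) * expR 1 ^+ n <= g ^+ n ->
  r%:R ^+ n <= g ^+ n * (r ^_ n)%:R :> R.
Proof.
move=> N0 nr g0; set N := (r - n)%N in N0 *; set e : R := expR 1 => H.
have e0 : 0 < e by exact: expR_gt0.
have r0 : (0 < r)%N by lia.
have rE : r = (N + n)%N by rewrite subnK.
have rr0 : 0 < r%:R :> R by rewrite ltr0n.
rewrite -(ler_pM2r (_ : 0 < N`!%:R * e ^+ N)); last first.
  by rewrite mulr_gt0 ?exprn_gt0 ?ltr0n ?fact_gt0.
apply: (@le_trans _ _ (r%:R ^+ n * (e * N%:R * N%:R ^+ N))).
  by rewrite ler_wpM2l ?exprn_ge0// fact_le_exp.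
have -> : g ^+ n * (r ^_ n)%:R * (N`!%:R * e ^+ N) = g ^+ n * (r`!%:R * e ^+ N).
  by rewrite -(ffact_fact nr) natrM; ring.
apply: (@le_trans _ _ (e * N%:R * (N%:R / r%:R) ^+ N * e ^+ n * (r`!%:R * e ^+ N))); last first.
  by rewrite ler_wpM2r// mulr_ge0 ?exprn_ge0// ltW.
have H2 := fact_ge_exp R r; rewrite -/e in H2.
apply: (@le_trans _ _ (e * N%:R * (N%:R / r%:R) ^+ N * r%:R ^+ r)).
  have -> : r%:R ^+ r = r%:R ^+ N * r%:R ^+ n :> R by rewrite -exprD -rE.
  rewrite expr_div_n.
  rewrite [leRHS](_ : _ = r%:R ^+ n * (e * N%:R * N%:R ^+ N))//.
  by field; rewrite expf_neq0// gt_eqF.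
have -> : e * N%:R * (N%:R / r%:R) ^+ N * e ^+ n * (r`!%:R * e ^+ N) =
    e * N%:R * (N%:R / r%:R) ^+ N * (e ^+ r * r`!%:R).
  by rewrite [in e ^+ r]rE exprD; ring.
rewrite ler_wpM2l// mulr_ge0 ?exprn_ge0 ?divr_ge0// mulr_ge0//; exact: ltW.
Qed.

Lemma powR_ratio_exprn (R : realType) (c x : R) (m : nat) : 0 < x -> x < c -> (0 < m)%N ->
  (((c - x) / c) `^ ((c - x) / x)) ^+ m =
  expR (- ((c - x) / x * m%:R * ln (1 + m%:R / ((c - x) / x * m%:R)))).
Proof.
move=> x0 xc m0; have c0 : 0 < c by rewrite (lt_trans x0).
have cx0 : 0 < c - x by rewrite subr_gt0.
have mm : m%:R != 0 :> R by rewrite pnatr_eq0 -lt0n.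
have -> : 1 + m%:R / ((c - x) / x * m%:R) = ((c - x) / c)^-1.
  by field; rewrite ?mm ?gt_eqF//=.
rewrite lnV ?posrE ?divr_gt0// mulrN opprK /powR gt_eqF ?divr_gt0//.
by rewrite -expRM_natl; congr expR; ring.
Qed.

Lemma exprn_ratio_le (R : realType) (r m : nat) (N0 : R) : 0 < N0 -> (m <= r)%N ->
  (r - m)%:R - N0 <= 1 ->
  (r%:R / (r - m)%:R) ^+ (r - m)
    <= expR (N0 * ln (1 + m%:R / N0)) * (1 + m%:R / N0) :> R.
Proof.
move=> N00 mr H; have q1 : 1 <= 1 + m%:R / N0 by rewrite lerDl divr_ge0// ltW.
have q0 : 0 < 1 + m%:R / N0 by rewrite (lt_le_trans ltr01).
have [->|Npos] := posnP (r - m)%N.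
  have e1 : 1 <= expR (N0 * ln (1 + m%:R / N0)).
    by rewrite -[leLHS]expR0 ler_expR mulr_ge0 ?ln_ge0// ltW.
  by rewrite expr0 -[leLHS]mulr1 ler_pM.
set N := (r - m)%N in Npos H *.
have N1 : 0 < N%:R :> R by rewrite ltr0n.
have -> : r%:R / N%:R = 1 + m%:R / N%:R :> R.
  have -> : r%:R = N%:R + m%:R :> R by rewrite -natrD subnK.
  by field; rewrite gt_eqF.
have p0 : 0 < 1 + m%:R / N%:R :> R by rewrite ltr_pwDl// divr_ge0.
rewrite -[X in X ^+ _](lnK (x := 1 + m%:R / N%:R)) ?posrE// -expRM_natl.
rewrite -[X in _ <= _ * X]lnK ?posrE// -expRD ler_expR.
exact: mul_ln1D_le.
Qed.

(** In this direction the rounding costs one factor [r / (r - m)], which turns the leading [r - m]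
    into [r]. *)
Lemma exprn_ratio_inv_le (R : realType) (r m : nat) (N0 : R) : 0 < N0 -> (m <= r)%N ->
  (0 < r - m)%N -> N0 - (r - m)%:R <= 1 ->
  (r - m)%:R * ((r - m)%:R / r%:R) ^+ (r - m)
    <= expR (- (N0 * ln (1 + m%:R / N0))) * r%:R :> R.
Proof.
move=> N00 mr Npos H; set N := (r - m)%N in Npos H *.
have N1 : 0 < N%:R :> R by rewrite ltr0n.
have r1 : 0 < r%:R :> R by rewrite ltr0n; lia.
have E : 1 + m%:R / N%:R = r%:R / N%:R :> R.
  have -> : r%:R = N%:R + m%:R :> R by rewrite -natrD subnK.
  by field; rewrite gt_eqF.
have p0 : 0 < r%:R / N%:R :> R by rewrite divr_gt0.
have := @mul_ln1D_le R m%:R N0 N%:R (ler0n _ _) N00 N1 H; rewrite E => K.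
rewrite mulrC -ler_pdivlMr// -[leRHS]mulrA -[N%:R / r%:R]invf_div exprVn.
rewrite -[X in X^-1](lnK (x := (r%:R / N%:R) ^+ N)) ?posrE ?exprn_gt0// lnXn//.
rewrite -[X in _ <= _ * X](lnK (x := r%:R / N%:R)) ?posrE// -expRN -expRD ler_expR.
by move: K; rewrite -mulr_natl; lra.
Qed.

Lemma first_moment_bound (R : realType) (n d m r : nat) (p q beta : R) :
  (n = m * d)%N -> (0 < n)%N -> (0 < r)%N -> (m <= r)%N -> 0 <= q -> 0 <= beta ->
  0 <= p <= q * beta * expR 1 ^+ (d + 1) / n%:R ^+ d ->
  n`!%:R * rainbow_prob r p m <=
    expR 1 ^+ 2 * n%:R * r%:R * q ^+ m * (beta ^+ m * (r%:R / (r - m)%:R) ^+ (r - m)).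
Proof.
move=> nE n0 r0 mr q0 b0 /andP[p0 pq]; set e : R := expR 1 in pq *.
have e0 : 0 < e by exact: expR_gt0.
have nn0 : 0 < n%:R :> R by rewrite ltr0n.
have rr0 : 0 < r%:R :> R by rewrite ltr0n.
rewrite rainbow_probE expr_div_n.
have H1 : n`!%:R <= e * n%:R * n%:R ^+ n / e ^+ n.
  by rewrite ler_pdivlMr ?exprn_gt0// fact_le_exp.
have H2 : p ^+ m <= (q * beta) ^+ m * e ^+ m * e ^+ n / n%:R ^+ n.
  have -> : (q * beta) ^+ m * e ^+ m * e ^+ n / n%:R ^+ n =
      (q * beta * e ^+ (d + 1) / n%:R ^+ d) ^+ m.
    rewrite expr_div_n [in RHS]exprMn -!exprM mulnDl mul1n exprD (mulnC d m) -nE.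
    by ring.
  by apply: lerXn2r; rewrite ?nnegrE// (le_trans p0).
have H3 := @ffact_expR_le R r m r0 mr; rewrite -/e in H3.
set G := (r%:R / (r - m)%:R) ^+ (r - m) in H3 *.
apply: (@le_trans _ _ (e * n%:R * n%:R ^+ n / e ^+ n *
   ((q * beta) ^+ m * e ^+ m * e ^+ n / n%:R ^+ n / r%:R ^+ m * (r ^_ m)%:R))).
  apply: ler_pM => //; first by rewrite !mulr_ge0// ?invr_ge0 exprn_ge0.
  by rewrite ler_wpM2r// ler_wpM2r// invr_ge0 exprn_ge0.
have -> : e * n%:R * n%:R ^+ n / e ^+ n *
   ((q * beta) ^+ m * e ^+ m * e ^+ n / n%:R ^+ n / r%:R ^+ m * (r ^_ m)%:R) =
   e * n%:R * (q * beta) ^+ m / r%:R ^+ m * ((r ^_ m)%:R * e ^+ m).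
  by field; rewrite !expf_neq0// gt_eqF.
apply: (@le_trans _ _ (e * n%:R * (q * beta) ^+ m / r%:R ^+ m * (e * r%:R * G * r%:R ^+ m))).
  rewrite ler_wpM2l// divr_ge0 ?exprn_ge0// mulr_ge0 ?exprn_ge0 ?mulr_ge0//; exact: ltW.
rewrite [leLHS](_ : _ = e ^+ 2 * n%:R * r%:R * q ^+ m * (beta ^+ m * G))//.
by rewrite exprMn; field; rewrite expf_neq0// gt_eqF.
Qed.

(** For [l >= 3] the condition on long gaps follows from the one on runs, because [m^2 (e / n)^l] is
    at most [e^3 / n]. *)
Lemma second_moment_whp_ge3 (R : realType) (k l d : nat) (r : nat -> nat)
    (p y : nat -> R) (rho : R) :
  (3 <= l)%N -> (l < k)%N -> d = (k - l)%N -> 0 < rho < 1 ->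
  (\forall n \near multiples_oo d, (n %/ d <= r n)%N) ->
  (\forall n \near multiples_oo d, 0 < p n <= 1) ->
  (\forall n \near multiples_oo d, 1 <= y n) ->
  (\forall n \near multiples_oo d, forall b, (b <= n %/ d)%N ->
     1 <= y n ^+ b * rainbow_prob (r n) (p n) b) ->
  (\forall n \near multiples_oo d,
     (expR 1 / n%:R) ^+ d * y n * (run_factor d k)%:R <= rho) ->
  whp d p (fun n (H : colored_hypergraph n k (r n)) => rainbow_hamiltonian l H).
Proof.
move=> l3 lk dE rho1 r_ge p01 y1 yQ yrho.
apply: (@second_moment_whp R k l d r p y rho) => //; first exact: ltnW.
move=> e e0.
have e3_near := @near_multiples_inv_le R d (expR 1 ^+ 3) e e0.
near=> n.
have rf1 : 1 <= (run_factor d k)%:R :> R.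
  by rewrite ler1n /run_factor; case: eqP => // _; rewrite expn_gt0; lia.
have en : expR 1 <= n%:R :> R by near: n; exact: near_multiples_ger.
have n0 : 0 < n%:R :> R by rewrite (lt_le_trans _ en)// expR_gt0.
have e3 : expR 1 ^+ 3 / n%:R <= e by near: n.
have yn : 1 <= y n by near: n.
have yr : (expR 1 / n%:R) ^+ d * y n * (run_factor d k)%:R <= rho by near: n.
set E : R := expR 1 / n%:R in yr *.
have E0 : 0 <= E by rewrite divr_ge0 ?expR_ge0.
have E1 : E <= 1 by rewrite ler_pdivrMr// mul1r.
have z0 : 0 <= E ^+ d * y n by rewrite mulr_ge0 ?exprn_ge0// (le_trans ler01).
have z1 : E ^+ d * y n <= 1.
  apply: (@le_trans _ _ rho); last by case/andP: rho1 => _ /ltW.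
  by apply: le_trans yr; rewrite ler_peMr.
apply: (@le_trans _ _ (((n %/ d) ^ 2)%:R * E ^+ l)).
  by rewrite ler_piMr// mulr_ge0 ?exprn_ge0.
apply: (@le_trans _ _ (n%:R ^+ 2 * E ^+ 3)).
  rewrite natrX; apply: ler_pM; rewrite ?exprn_ge0//.
    by apply: lerXn2r; rewrite ?nnegrE// ler_nat leq_div.
  by apply: ler_wiXn2l.
rewrite [leLHS](_ : _ = expR 1 ^+ 3 / n%:R)//.
by rewrite /E; field; rewrite gt_eqF.
Unshelve. all: by end_near. Qed.

Lemma near_admissible (R : realType) (d : nat) (c : R) (r : nat -> nat) (p : nat -> R) :
  (0 < d)%N -> admissible d c r p ->
  (\forall n \near multiples_oo d, (n %/ d <= r n)%N) /\
  (\forall n \near multiples_oo d, (0 < r n)%N /\ 0 <= p n <= 1).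
Proof.
move=> d0 adm.
have r_ge : \forall n \near multiples_oo d, (n %/ d <= r n)%N.
  near=> n; apply: (admissible_ge d0 adm); near: n; exact: near_multiples_dvd.
split=> //; near=> n.
have dn : (d %| n)%N by near: n; exact: near_multiples_dvd.
have [_ _ p01] := adm; split; last exact: p01.
apply: leq_trans (_ : (n %/ d <= _)%N); last by near: n.
near: n; exact: near_multiples_div_ge.
Unshelve. all: by end_near. Qed.

Lemma near_expR_scaling (R : realType) (d : nat) (c : R) (r : nat -> nat) (p : nat -> R) :
  (0 < d)%N -> admissible d c r p ->
  (\forall n \near multiples_oo d, 0 < p n) ->
  [/\ \forall n \near multiples_oo d, 0 < p n <= 1,
      \forall n \near multiples_oo d, 1 <= expR 1 / p n
    & \forall n \near multiples_oo d, forall b, (b <= n %/ d)%N ->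
        1 <= (expR 1 / p n) ^+ b * rainbow_prob (r n) (p n) b].
Proof.
move=> d0 adm p0; have [r_ge rp] := near_admissible d0 adm; split; near=> n.
- have [_ /andP[_ ->]] : (0 < r n)%N /\ 0 <= p n <= 1 by near: n.
  by rewrite andbT; near: n.
- have [_ /andP[_ p1]] : (0 < r n)%N /\ 0 <= p n <= 1 by near: n.
  have pn : 0 < p n by near: n.
  rewrite ler_pdivlMr// mul1r (le_trans p1)//.
  by rewrite -[leLHS]expR0 ler_expR.
- have [rn _] : (0 < r n)%N /\ 0 <= p n <= 1 by near: n.
  have pn : 0 < p n by near: n.
  have mr : (n %/ d <= r n)%N by near: n.
  move=> b bm; apply: scaled_rainbow_prob_ge1 => //.
  by apply: expr_le_ffact_expR; apply: leq_trans mr.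
Unshelve. all: by end_near. Qed.

(** With [g = e] a run costs [e^(d + 1) / (n^d p)] times [run_factor d k], itself at most
    [k ^ k.+1]; the constant makes this at most [1 / 2] for all [l] at once. *)
Lemma whp_rainbow_ge3 (R : realType) (k l : nat) (c : R) (r : nat -> nat) (p : nat -> R) :
  (3 <= l)%N -> (l < k)%N -> admissible (k - l) c r p ->
  (\forall n \near multiples_oo (k - l),
     2 * expR 1 ^+ k.+1 * (k ^ k.+1)%:R / n%:R ^+ (k - l) <= p n) ->
  whp (k - l) p (fun n (H : colored_hypergraph n k (r n)) => rainbow_hamiltonian l H).
Proof.
move=> l3 lk adm pK; set d := (k - l)%N in adm pK *.
have d0 : (0 < d)%N by rewrite /d; lia.
have dk : (d <= k)%N by rewrite /d; lia.
have k0 : (0 < k)%N by lia.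
have e0 : 0 < expR 1 :> R by exact: expR_gt0.
have kk : 0 < (k ^ k.+1)%:R :> R by rewrite ltr0n expn_gt0 k0.
have K0 : 0 < 2 * expR 1 ^+ k.+1 * (k ^ k.+1)%:R :> R.
  by rewrite !mulr_gt0 ?exprn_gt0.
have p0 : \forall n \near multiples_oo d, 0 < p n.
  near=> n; have n0 : (0 < n)%N by near: n; exact: near_multiples_ge.
  apply: (@lt_le_trans _ _ (2 * expR 1 ^+ k.+1 * (k ^ k.+1)%:R / n%:R ^+ d)).
    by rewrite divr_gt0// exprn_gt0 ?ltr0n.
  by near: n.
have [r_ge _] := near_admissible d0 adm.
have [p01 y1 yQ] := near_expR_scaling d0 adm p0.
apply: (@second_moment_whp_ge3 R k l d r p (fun n => expR 1 / p n) 2^-1) => //.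
  by apply/andP; split; lra.
near=> n.
have n0 : (0 < n)%N by near: n; exact: near_multiples_ge.
have nn0 : 0 < n%:R ^+ d :> R by rewrite exprn_gt0 ?ltr0n.
have pn : 0 < p n by near: n.
have pKn : 2 * expR 1 ^+ k.+1 * (k ^ k.+1)%:R / n%:R ^+ d <= p n by near: n.
rewrite scaled_weight -exprS mulrAC ler_pdivrMr ?mulr_gt0//.
rewrite ler_pdivlMl//.
apply: (@le_trans _ _ (2 * expR 1 ^+ k.+1 * (k ^ k.+1)%:R)); last first.
  by rewrite [leRHS]mulrC -ler_pdivrMr.
rewrite -mulrA ler_wpM2l//; apply: ler_pM; rewrite ?exprn_ge0 ?(ltW e0)//.
  by apply: ler_weXn2l; rewrite // -[leLHS]expR0 ler_expR.
by rewrite ler_nat /run_factor; case: eqP => // _; rewrite expn_gt0 k0.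
Unshelve. all: by end_near. Qed.

Lemma whp_rainbow_2 (R : realType) (k : nat) (c : R) (r : nat -> nat) (p omega : nat -> R) :
  (2 < k)%N -> admissible (k - 2) c r p ->
  omega n @[n --> multiples_oo (k - 2)] --> +oo ->
  (\forall n \near multiples_oo (k - 2), omega n / n%:R ^+ (k - 2) <= p n) ->
  whp (k - 2) p (fun n (H : colored_hypergraph n k (r n)) => rainbow_hamiltonian 2 H).
Proof.
move=> k2 adm om pom; set d := (k - 2)%N in adm om pom *.
have d0 : (0 < d)%N by rewrite /d; lia.
have k0 : (0 < k)%N by lia.
have e0 : 0 < expR 1 :> R by exact: expR_gt0.
have omge (X : R) : \forall n \near multiples_oo d, X <= n%:R ^+ d * p n.
  near=> n; have n0 : (0 < n)%N by near: n; exact: near_multiples_ge.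
  have nn0 : 0 < n%:R ^+ d :> R by rewrite exprn_gt0 ?ltr0n.
  rewrite mulrC -ler_pdivrMr//; apply: (@le_trans _ _ (omega n / n%:R ^+ d)).
    rewrite ler_pM2r ?invr_gt0//; near: n; move: X; exact/cvgryPge.
  by near: n.
have p0 : \forall n \near multiples_oo d, 0 < p n.
  near=> n; have n0 : (0 < n)%N by near: n; exact: near_multiples_ge.
  have nn0 : 0 < n%:R ^+ d :> R by rewrite exprn_gt0 ?ltr0n.
  rewrite -(pmulr_rgt0 _ nn0) (@lt_le_trans _ _ 1)//; near: n; exact: omge.
have [r_ge _] := near_admissible d0 adm.
have [p01 y1 yQ] := near_expR_scaling d0 adm p0.
have zle (e : R) : 0 < e -> \forall n \near multiples_oo d,
    (expR 1 / n%:R) ^+ d * (expR 1 / p n) <= e.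
  move=> e_0; near=> n.
  have n0 : (0 < n)%N by near: n; exact: near_multiples_ge.
  have nn0 : 0 < n%:R ^+ d :> R by rewrite exprn_gt0 ?ltr0n.
  have pn : 0 < p n by near: n.
  rewrite scaled_weight ler_pdivrMr ?mulr_gt0// -ler_pdivrMl//; near: n; exact: omge.
have rf0 : 0 < (run_factor d k)%:R :> R.
  by rewrite ltr0n /run_factor; case: eqP => // _; rewrite expn_gt0 k0.
apply: (@second_moment_whp R k 2 d r p (fun n => expR 1 / p n) 2^-1) => //.
- by apply/andP; split; lra.
- near=> n; rewrite -ler_pdivlMr//; near: n; apply: zle.
  by rewrite divr_gt0// invr_gt0.
move=> e e_0; near=> n.
have n0 : (0 < n)%N by near: n; exact: near_multiples_ge.
have nn0 : 0 < n%:R :> R by rewrite ltr0n.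
have pn : 0 < p n by near: n.
have z0 : 0 <= (expR 1 / n%:R) ^+ d * (expR 1 / p n).
  by rewrite mulr_ge0 ?exprn_ge0 ?divr_ge0// ltW.
have zn : (expR 1 / n%:R) ^+ d * (expR 1 / p n) <= e / expR 1 ^+ 2.
  by near: n; apply: zle; rewrite divr_gt0 ?exprn_gt0.
rewrite ler_pdivlMr ?exprn_gt0// mulrC in zn.
apply: le_trans zn; rewrite ler_wpM2r// expr_div_n mulrCA ler_piMr ?exprn_ge0 ?(ltW e0)//.
rewrite natrX ler_pdivrMr ?exprn_gt0// mul1r.
by apply: lerXn2r; rewrite ?nnegrE// ler_nat leq_div.
Unshelve. all: by end_near. Qed.

Definition color_factor (R : realType) (d : nat) (c : R) : R :=
  if c == 1 / d%:R then 1 else ((c - 1 / d%:R) / c) `^ (d%:R * c - 1).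

Lemma color_factor_expR (R : realType) (d m : nat) (c : R) (N0 : R) :
  (0 < d)%N -> (0 < m)%N -> 1 / d%:R < c -> N0 = c * (m * d)%:R - m%:R ->
  [/\ 0 < N0, color_factor d c ^+ m = expR (- (N0 * ln (1 + m%:R / N0)))
    & 1 + m%:R / N0 = c / (c - 1 / d%:R)].
Proof.
move=> d0 m0 cd N0E; have dd : 0 < d%:R :> R by rewrite ltr0n.
have mm : 0 < m%:R :> R by rewrite ltr0n.
have x0 : 0 < 1 / d%:R :> R by rewrite divr_gt0.
have cx : 0 < c - 1 / d%:R by rewrite subr_gt0.
have NE : N0 = (c - 1 / d%:R) / (1 / d%:R) * m%:R.
  by rewrite N0E natrM; field; rewrite ?gt_eqF//=.
have N00 : 0 < N0 by rewrite NE mulr_gt0// divr_gt0.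
split=> //; last first.
  by rewrite NE; field; rewrite ?gt_eqF//= subr_gt0 mulrC -ltr_pdivrMl// mulrC.
rewrite /color_factor gt_eqF// NE -powR_ratio_exprn//; congr (_ `^ _ ^+ _).
by field; rewrite ?gt_eqF.
Qed.

Lemma near_color_factor_ub (R : realType) (d : nat) (c : R) (r : nat -> nat) (p : nat -> R) :
  (0 < d)%N -> admissible d c r p -> exists2 X : R, 0 < X &
    \forall n \near multiples_oo d, color_factor d c ^+ (n %/ d) *
       ((r n)%:R / (r n - n %/ d)%:R) ^+ (r n - n %/ d) <= X.
Proof.
move=> d0 adm; have [cd rr _] := adm; have dd : 0 < d%:R :> R by rewrite ltr0n.
have [cE|cN] := eqVneq c (1 / d%:R).
  exists 1 => //; near=> n.
  have dn : (d %| n)%N by near: n; exact: near_multiples_dvd.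
  have [_ _ _ /(_ (n %/ d)%N)] := rounding_bounds (rr n dn).
  rewrite /color_factor cE eqxx expr1n mul1r => rm.
  rewrite (_ : (r n - n %/ d)%N = 0%N) ?expr0//; apply/eqP; rewrite subn_eq0; apply: rm.
  by rewrite mulrC ler_pdivrMr// -natrM divnK.
have cd' : 1 / d%:R < c by rewrite lt_neqAle eq_sym cN.
have cx : 0 < c - 1 / d%:R by rewrite subr_gt0.
have c0 : 0 < c by apply: lt_trans cd'; rewrite divr_gt0.
exists (c / (c - 1 / d%:R)); first by rewrite divr_gt0.
near=> n.
have dn : (d %| n)%N by near: n; exact: near_multiples_dvd.
have m0 : (0 < n %/ d)%N by near: n; exact: near_multiples_div_ge.
have mr := admissible_ge d0 adm dn.
have [rn _ _ _] := rounding_bounds (rr n dn).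
pose N0 : R := c * (n %/ d * d)%:R - (n %/ d)%:R.
have [N00 -> E] := color_factor_expR d0 m0 cd' (erefl N0).
have H : (r n - n %/ d)%:R - N0 <= 1 by rewrite natrB// /N0 divnK//; lra.
apply: (le_trans (ler_wpM2l _ (exprn_ratio_le N00 mr H))); first exact: expR_ge0.
by rewrite mulrA -expRD addNr expR0 E -[leRHS]mul1r.
Unshelve. all: by end_near. Qed.

Lemma admissible_le (R : realType) (d : nat) (c : R) (r : nat -> nat) (p : nat -> R) (n : nat) :
  (0 < n)%N -> admissible d c r p -> (d %| n)%N -> (r n)%:R <= (c + 1) * n%:R.
Proof.
move=> n0 [_ rr _] dn; have [+ _ _ _] := rounding_bounds (rr n dn).
have n1 : 1 <= n%:R :> R by rewrite ler1n.
by lra.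
Qed.

Lemma whp_not_rainbow (R : realType) (k l : nat) (eps c : R) (r : nat -> nat) (p : nat -> R) :
  (0 < l)%N -> (l < k)%N -> 0 < eps -> admissible (k - l) c r p ->
  (\forall n \near multiples_oo (k - l),
     p n <= (1 - eps) * color_factor (k - l) c * expR 1 ^+ (k - l + 1) / n%:R ^+ (k - l)) ->
  whp (k - l) p (fun n (H : colored_hypergraph n k (r n)) => ~~ rainbow_hamiltonian l H).
Proof.
move=> l0 lk eps0 adm pub; have [cd _ _] := adm.
have d0 : (0 < k - l)%N by lia.
have k0 : (0 < k)%N by lia.
have [X X0 HX] := near_color_factor_ub d0 adm.
have [r_ge rp] := near_admissible d0 adm.
set d := (k - l)%N in d0 adm pub cd HX r_ge rp *.
have c0 : 0 < c by apply: lt_le_trans cd; rewrite divr_gt0// ltr0n.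
(* The maximum keeps [q] positive when [eps >= 1]. *)
pose q : R := Num.max (1 - eps) 2^-1.
have q0 : 0 < q by rewrite lt_max invr_gt0 ltr0n orbT.
have q1 : q < 1 by rewrite gt_max; apply/andP; split; lra.
have qeps : 1 - eps <= q by rewrite le_max lexx.
have a1 : 1 < q^-1 by rewrite invf_gt1.
(* The first moment carries a factor of order [n^2]; the third power leaves [C / m], which tends to
   0. *)
have [C C0 HC] := exprn_poly_bound 3 a1.
have beta0 : 0 <= color_factor d c by rewrite /color_factor; case: ifP => // _; exact: powR_ge0.
apply: whp_of_prob_not_le => // e e0.
pose B : R := expR 1 ^+ 2 * (c + 1) * X * d%:R ^+ 2 * C.
have B_near := @near_multiples_div_ger R d (B / e) d0.
near=> n.
have dn : (d %| n)%N by near: n; exact: near_multiples_dvd.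
have km : (2 * k <= n %/ d)%N by near: n; exact: near_multiples_div_ge.
have Bm : B / e <= (n %/ d)%:R by near: n.
have [rn pn] : (0 < r n)%N /\ 0 <= p n <= 1 by near: n.
have mr : (n %/ d <= r n)%N by near: n.
have HXn : color_factor d c ^+ (n %/ d) *
   ((r n)%:R / (r n - n %/ d)%:R) ^+ (r n - n %/ d) <= X by near: n.
have pubn : p n <= (1 - eps) * color_factor d c * expR 1 ^+ (d + 1) / n%:R ^+ d by near: n.
have m0 : (0 < n %/ d)%N by apply: leq_trans km; rewrite muln_gt0 k0.
have nE : n = (n %/ d * d)%N by rewrite divnK.
have n0 : (0 < n)%N by rewrite nE muln_gt0 m0 d0.
have rc := admissible_le n0 adm dn.
pose RH (H : colored_hypergraph n k (r n)) := rainbow_hamiltonian l H.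
rewrite /prob (eq_bigl RH); last first.
  by move=> H; rewrite negbK.
apply: (le_trans (prob_rainbow_hamiltonian_le l0 lk dn km rn pn)).
have pq : 0 <= p n <= q * color_factor d c * expR 1 ^+ (d + 1) / n%:R ^+ d.
  case/andP: pn => -> _ /=; apply: (le_trans pubn).
  by rewrite !ler_wpM2r// ?invr_ge0 exprn_ge0// expR_ge0.
apply: (le_trans (first_moment_bound nE n0 rn mr (ltW q0) beta0 pq)).
set m := (n %/ d)%N in km Bm mr HXn m0 nE *.
have mm0 : 0 < m%:R :> R by rewrite ltr0n.
apply: (@le_trans _ _ (expR 1 ^+ 2 * n%:R * ((c + 1) * n%:R) * q ^+ m * X)).
  apply: ler_pM => //.
  - by rewrite !mulr_ge0 ?exprn_ge0 ?expR_ge0// ltW.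
  - by rewrite mulr_ge0 ?exprn_ge0// divr_ge0.
  - rewrite ler_wpM2r ?exprn_ge0 ?(ltW q0)// ler_wpM2l// mulr_ge0 ?exprn_ge0//; exact: expR_ge0.
have -> : expR 1 ^+ 2 * n%:R * ((c + 1) * n%:R) * q ^+ m * X =
    expR 1 ^+ 2 * (c + 1) * X * d%:R ^+ 2 * (m%:R ^+ 2 * q ^+ m).
  by rewrite [in LHS]nE natrM; ring.
have qm : m%:R ^+ 2 * q ^+ m <= C / m%:R.
  rewrite ler_pdivlMr// mulrAC -exprSr -[q ^+ m]invrK -exprVn.
  by rewrite ler_pdivrMr ?exprn_gt0 ?invr_gt0.
apply: (@le_trans _ _ (B / m%:R)).
  rewrite /B -[leRHS]mulrA ler_wpM2l//.
  by rewrite !mulr_ge0 ?exprn_ge0 ?expR_ge0 ?addr_ge0// ltW.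
by rewrite ler_pdivrMr// mulrC -ler_pdivrMr.
Unshelve. all: by end_near. Qed.

(** The factor [(1 + eta) ^+ n] absorbs the polynomial loss in Stirling's estimate and in the
    rounding. *)
Lemma near_color_factor_lb (R : realType) (c eta : R) (r : nat -> nat) (p : nat -> R) :
  0 < eta -> admissible 1 c r p ->
  \forall n \near multiples_oo 1, (r n)%:R ^+ n
     <= (expR 1 * color_factor 1 c * (1 + eta)) ^+ n * (r n ^_ n)%:R.
Proof.
move=> eta0 adm; have [cd rr _] := adm; rewrite divr1 in cd.
have e0 : 0 < expR 1 :> R by exact: expR_gt0.
have eta1 : 1 <= 1 + eta by rewrite lerDl ltW.
have [cE|cN] := eqVneq c 1.
  near=> n; have nr := @admissible_ge R 1 c r p n isT adm (dvd1n n).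
  rewrite divn1 in nr.
  rewrite /color_factor divr1 cE eqxx mulr1 exprMn.
  by apply: (le_trans (expr_le_ffact_expR R nr)); rewrite ler_wpM2r// ler_peMr ?exprn_ege1.
have c1 : 1 / 1%:R < c by rewrite divr1 lt_neqAle eq_sym cN.
have c1' : 0 < c - 1 by rewrite -(divr1 1) subr_gt0.
have a1 : 1 < 1 + eta by rewrite ltrDl.
have [C C0 HC] := exprn_poly_bound 2 a1.
have C_near := @near_multiples_ger R 1 (expR 1 * (c + 1) * C).
have c_near := @near_multiples_ger R 1 (2 / (c - 1)).
near=> n.
have n0 : (0 < n)%N by near: n; exact: near_multiples_ge.
have nn0 : 0 < n%:R :> R by rewrite ltr0n.
have Cn : expR 1 * (c + 1) * C <= n%:R by near: n.
have cn : 2 / (c - 1) <= n%:R by near: n.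
have nr := @admissible_ge R 1 c r p n isT adm (dvd1n n); rewrite divn1 in nr.
have rc := admissible_le n0 adm (dvd1n n).
have [_ rn _ _] := rounding_bounds (rr n (dvd1n n)).
pose N0 : R := c * (n * 1)%:R - n%:R.
have [N00 bE _] := @color_factor_expR R 1 n c N0 isT n0 c1 erefl.
have N0E : N0 = (c - 1) * n%:R by rewrite /N0 muln1; ring.
have N2 : 2 <= N0 by rewrite N0E mulrC -ler_pdivrMr.
have H : N0 - (r n - n)%:R <= 1 by rewrite natrB// /N0 muln1; lra.
have Npos : (0 < r n - n)%N by rewrite -(ltr0n R); lra.
have b0 : 0 <= color_factor 1 c by rewrite /color_factor; case: ifP => // _; exact: powR_ge0.
apply: expr_le_ffact_of => //; first by rewrite !mulr_ge0// ltW// addr_gt0.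
rewrite -[_ * (r n - n)%:R * _]mulrA.
have K := exprn_ratio_inv_le N00 nr Npos H; rewrite -bE in K.
apply: (@le_trans _ _ (expR 1 * (color_factor 1 c ^+ n * (r n)%:R) * expR 1 ^+ n)).
  by rewrite ler_wpM2r ?exprn_ge0 ?(ltW e0)// ler_wpM2l// ltW.
rewrite !exprMn.
have -> : expR 1 * (color_factor 1 c ^+ n * (r n)%:R) * expR 1 ^+ n =
   expR 1 ^+ n * color_factor 1 c ^+ n * (expR 1 * (r n)%:R) by ring.
rewrite ler_wpM2l ?mulr_ge0 ?exprn_ge0 ?(ltW e0)//.
apply: (@le_trans _ _ (expR 1 * ((c + 1) * n%:R))); first by rewrite ler_wpM2l// ltW.
rewrite -(ler_pM2r nn0).
have -> : expR 1 * ((c + 1) * n%:R) * n%:R = expR 1 * (c + 1) * n%:R ^+ 2 by ring.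
have ec0 : 0 <= expR 1 * (c + 1) by rewrite mulr_ge0 ?(ltW e0)//; lra.
apply: (le_trans (ler_wpM2l ec0 (HC n))).
rewrite mulrA [leRHS]mulrC ler_wpM2r// exprn_ge0//; lra.
Unshelve. all: by end_near. Qed.

Lemma whp_rainbow_tight (R : realType) (k : nat) (eps c : R) (r : nat -> nat) (p : nat -> R) :
  (4 <= k)%N -> 0 < eps -> admissible 1 c r p ->
  (\forall n \near multiples_oo 1, (1 + eps) * color_factor 1 c * expR 1 ^+ 2 / n%:R <= p n) ->
  whp 1 p (fun n (H : colored_hypergraph n k (r n)) => rainbow_hamiltonian (k - 1) H).
Proof.
move=> k4 eps0 adm plb; have [cd rr _] := adm; rewrite divr1 in cd.
have e0 : 0 < expR 1 :> R by exact: expR_gt0.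
pose b : R := color_factor 1 c.
have b0 : 0 < b.
  rewrite /b /color_factor !divr1; case: eqVneq => // cN; apply: powR_gt0.
  have c1 : 1 < c by rewrite lt_neqAle eq_sym cN.
  by rewrite divr_gt0 ?subr_gt0// (lt_trans ltr01).
have eps2 : 0 < eps / 2 by rewrite divr_gt0.
(* Half of [eps] is spent on reaching all overlaps; the other half leaves [rho < 1], as a tight run
   step loses no constant. *)
pose g : R := expR 1 * b * (1 + eps / 2).
have g0 : 0 < g by rewrite !mulr_gt0// addr_gt0.
have gcol := near_color_factor_lb eps2 adm.
have [r_ge rp] := @near_admissible R 1 c r p isT adm.
have k1 : (k - 1 < k)%N by lia.
have k3 : (3 <= k - 1)%N by lia.
have dE : 1%N = (k - (k - 1))%N by lia.
have plb0 n : (0 < n)%N -> 0 < (1 + eps) * b * expR 1 ^+ 2 / n%:R.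
  by move=> n0; rewrite divr_gt0 ?ltr0n// !mulr_gt0 ?exprn_gt0// addr_gt0.
have p01 : \forall n \near multiples_oo 1, 0 < p n <= 1.
  near=> n; have n0 : (0 < n)%N by near: n; exact: near_multiples_ge.
  have [_ /andP[_ ->]] : (0 < r n)%N /\ 0 <= p n <= 1 by near: n.
  by rewrite andbT (lt_le_trans (plb0 n n0))//; near: n.
have gffact : \forall n \near multiples_oo 1, forall j, (j <= n)%N ->
    (r n)%:R ^+ j <= g ^+ j * (r n ^_ j)%:R.
  near=> n => j jn.
  have nr : (n %/ 1 <= r n)%N by near: n.
  rewrite divn1 in nr.
  by apply: (expr_le_ffact g0 nr _ jn); near: n.
pose rho : R := (1 + eps / 2) / (1 + eps).
have eps1 : 0 < 1 + eps by rewrite addr_gt0.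
apply: (@second_moment_whp_ge3 R k (k - 1) 1 r p (fun n => g / p n) rho) => //.
- apply/andP; split; first by rewrite divr_gt0// addr_gt0.
  by rewrite /rho ltr_pdivrMr//; lra.
- near=> n; have n0 : (0 < n)%N by near: n; exact: near_multiples_ge.
  have [rn _] : (0 < r n)%N /\ 0 <= p n <= 1 by near: n.
  have /andP[pn p1] : 0 < p n <= 1 by near: n.
  have gf : forall j, (j <= n)%N -> (r n)%:R ^+ j <= g ^+ j * (r n ^_ j)%:R by near: n.
  rewrite ler_pdivlMr// mul1r (le_trans p1)//.
  have := gf 1%N n0; rewrite !expr1 ffactn1 -[leLHS]mul1r ler_pM2r// ltr0n//.
- near=> n => j jn.
  have [rn _] : (0 < r n)%N /\ 0 <= p n <= 1 by near: n.
  have /andP[pn _] : 0 < p n <= 1 by near: n.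
  have gf : forall j, (j <= n)%N -> (r n)%:R ^+ j <= g ^+ j * (r n ^_ j)%:R by near: n.
  by apply: scaled_rainbow_prob_ge1 => //; apply: gf; rewrite divn1 in jn.
- near=> n; have n0 : (0 < n)%N by near: n; exact: near_multiples_ge.
  have nn0 : 0 < n%:R :> R by rewrite ltr0n.
  have /andP[pn _] : 0 < p n <= 1 by near: n.
  have plbn : (1 + eps) * b * expR 1 ^+ 2 / n%:R <= p n by near: n.
  rewrite scaled_weight /run_factor eqxx mulr1 !expr1 ler_pdivrMr ?mulr_gt0//.
  rewrite ler_pdivrMr// in plbn.
  have -> : g * expR 1 = rho * ((1 + eps) * b * expR 1 ^+ 2).
    by rewrite /g /rho; field; rewrite gt_eqF.
  have rho0 : 0 <= rho by rewrite divr_ge0 ?addr_ge0// ltW.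
  by rewrite [n%:R * p n]mulrC ler_wpM2l.
Unshelve. all: by end_near. Qed.

Theorem theorem5 (R : realType) :
  [/\ (* (i) *)
      forall (k l : nat) (eps c : R) (r : nat -> nat) (p : nat -> R),
        (2 <= l)%N -> (l < k)%N -> 0 < eps ->
        admissible (k - l) c r p ->
        (\forall n \near multiples_oo (k - l),
           p n <= (if c == 1 / (k - l)%:R
                   then (1 - eps) * expR 1 ^+ (k - l + 1) / n%:R ^+ (k - l)
                   else (1 - eps)
                        * ((c - 1 / (k - l)%:R) / c) `^ ((k - l)%:R * c - 1)
                        * expR 1 ^+ (k - l + 1) / n%:R ^+ (k - l))) ->
        whp (k - l) p (fun n (H : colored_hypergraph n k (r n)) =>
                         ~~ rainbow_hamiltonian l H),
      (* (ii) *)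
      forall k : nat, exists K : R,
        forall (l : nat) (c : R) (r : nat -> nat) (p : nat -> R),
        (3 <= l)%N -> (l < k)%N ->
        admissible (k - l) c r p ->
        (\forall n \near multiples_oo (k - l), K / n%:R ^+ (k - l) <= p n) ->
        whp (k - l) p (fun n (H : colored_hypergraph n k (r n)) =>
                         rainbow_hamiltonian l H),
      (* (iii) *)
      forall (k : nat) (c : R) (r : nat -> nat) (p omega : nat -> R),
        (2 < k)%N ->
        admissible (k - 2) c r p ->
        omega n @[n --> multiples_oo (k - 2)] --> +oo ->
        (\forall n \near multiples_oo (k - 2),
           omega n / n%:R ^+ (k - 2) <= p n) ->
        whp (k - 2) p (fun n (H : colored_hypergraph n k (r n)) =>
                         rainbow_hamiltonian 2 H)
    & (* (iv) *)
      forall (k : nat) (eps c : R) (r : nat -> nat) (p : nat -> R),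
        (4 <= k)%N -> 0 < eps ->
        admissible 1 c r p ->
        (\forall n \near multiples_oo 1,
           (if c == 1
            then (1 + eps) * expR 1 ^+ 2 / n%:R
            else (1 + eps) * ((c - 1) / c) `^ (c - 1) * expR 1 ^+ 2 / n%:R)
           <= p n) ->
        whp 1 p (fun n (H : colored_hypergraph n k (r n)) =>
                   rainbow_hamiltonian (k - 1) H)].
Proof.
split.
- move=> k l eps c r p l2 lk eps0 adm pub.
  apply: (@whp_not_rainbow R k l eps c r p) => //; first exact: ltnW.
  near=> n; rewrite /color_factor.
  have : p n <= (if c == 1 / (k - l)%:R
                   then (1 - eps) * expR 1 ^+ (k - l + 1) / n%:R ^+ (k - l)
                   else (1 - eps)
                        * ((c - 1 / (k - l)%:R) / c) `^ ((k - l)%:R * c - 1)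
                        * expR 1 ^+ (k - l + 1) / n%:R ^+ (k - l)) by near: n.
  by case: ifP => // _; rewrite mulr1.
- move=> k; exists (2 * expR 1 ^+ k.+1 * (k ^ k.+1)%:R) => l c r p l3 lk adm pK.
  exact: (@whp_rainbow_ge3 R k l c r p).
- move=> k c r p omega; exact: whp_rainbow_2.
- move=> k eps c r p k4 eps0 adm plb.
  apply: (@whp_rainbow_tight R k eps c r p) => //.
  near=> n; rewrite /color_factor !divr1 mul1r.
  have : (if c == 1
            then (1 + eps) * expR 1 ^+ 2 / n%:R
            else (1 + eps) * ((c - 1) / c) `^ (c - 1) * expR 1 ^+ 2 / n%:R) <= p n by near: n.
  by case: ifP => // _; rewrite mulr1.
Unshelve. all: by end_near. Qed.
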